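(* Let $X$ be a mixing shift of finite type, $Y$ a mixing sofic shift, and $\pi: X \to Y$ a factor code. Let $Z$ be a subshift with topological entropy $h(Z) < h(Y)$. Then there exist a subshift $Z'$, a finite-to-one factor code $\chi: Z' \to Z$, and a sliding block code $\psi: Z' \to X$ such that $\pi \circ \psi$ is injective. Moreover, if $Z$ is mixing sofic with positive entropy (i.e. not a single fixed point), then $Z'$ can be taken to be a mixing shift of finite type and $\chi$ can be taken to be almost invertible.
   Context: A subshift is a closed, shift-invariant subset of $\mathcal{A}^{\mathbb{Z}}$ for a finite alphabet $\mathcal{A}$ (product topology, shift $(\sigma x)_i = x_{i+1}$). For a subshift $S$, $\mathcal{B}(S)$ is its language (the finite words appearing in points of $S$) and $\mathcal{B}_n(S)$ the words in it of length $n$. A sliding block code is a continuous shift-commuting map between subshifts; a factor code is a surjective sliding block code. A shift of finite type (SFT) is a subshift defined by a finite set of forbidden words; a sofic shift is a factor of an SFT. A subshift $S$ is strongly irreducible with gap $g \geq 1$ if for all $u,w \in \mathcal{B}(S)$ there is $v \in \mathcal{B}_g(S)$ with $uvw \in \mathcal{B}(S)$; ''mixing SFT'' and ''mixing sofic shift'' mean strongly irreducible SFT and strongly irreducible sofic shift. The entropy is $h(S) = \lim_{n} \frac1n \log |\mathcal{B}_n(S)|$. A code is finite-to-one if every fiber is finite. For a finite-to-one factor code on an irreducible SFT, the minimum fiber cardinality is attained generically and is called the degree; the code is almost invertible if its degree is $1$. *)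

(* Defs.v *)
From HB Require Import structures.
From mathcomp Require Import all_boot all_order all_algebra.
From mathcomp Require Import all_classical all_reals all_analysis.

Set Implicit Arguments.
Unset Strict Implicit.
Unset Printing Implicit Defensive.

Import Order.TTheory GRing.Theory Num.Theory.

Local Open Scope classical_set_scope.
Local Open Scope ring_scope.

Definition config (A : finType) : Type := {ptws int -> discrete_topology A}.

Definition shift_map (A : finType) (x : config A) : config A := fun i => x (i + 1).

(* Shift-invariance is the two-sided condition [shift_map S = S].  The empty set is
   a subshift, with empty language and, below, entropy [-oo]. *)
Definition subshift (A : finType) (S : set (config A)) : Prop :=
  closed S /\ (@shift_map A) @` S = S.

Definition block (A : finType) (x : config A) (i : int) (n : nat) : seq A :=
  [seq x (i + k%:Z) | k <- iota 0 n].

Definition occurs (A : finType) (w : seq A) (x : config A) : Prop :=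
  exists i : int, w = block x i (size w).

Definition language (A : finType) (S : set (config A)) : set (seq A) :=
  [set w | exists2 x, S x & occurs w x].

Definition nblocks (A : finType) (S : set (config A)) (n : nat) : nat :=
  #|[set w : n.-tuple A | `[< language S w >]]%SET|.

(* [lne] is the logarithm on [\bar R], with [lne 0 = -oo]. *)
Definition entropy (R : realType) (A : finType) (S : set (config A)) : \bar R :=
  limn (fun n : nat => (n%:R^-1%:E * lne (nblocks S n)%:R%:E)%E).

Definition strongly_irreducible_gap (A : finType) (S : set (config A))
    (g : nat) : Prop :=
  (1 <= g)%N /\
  forall u w : seq A, language S u -> language S w ->
    exists v : seq A, [/\ size v = g, language S v & language S (u ++ v ++ w)].

Definition strongly_irreducible (A : finType) (S : set (config A)) : Prop :=
  exists g : nat, strongly_irreducible_gap S g.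

(* Continuity is for the subspace topology on [S]; the values of [f] outside
   [S] play no role. *)
Definition sliding_block_code (A B : finType) (S : set (config A))
    (T : set (config B)) (f : config A -> config B) : Prop :=
  [/\ {within S, continuous f},
      set_fun S T f
    & forall x, S x -> f (shift_map x) = shift_map (f x)].

Definition factor_code (A B : finType) (S : set (config A))
    (T : set (config B)) (f : config A -> config B) : Prop :=
  sliding_block_code S T f /\ set_surj S T f.

Definition sft (A : finType) (S : set (config A)) : Prop :=
  subshift S /\
  exists F : seq (seq A), S = [set x | forall w, w \in F -> ~ occurs w x].

Definition sofic (A : finType) (S : set (config A)) : Prop :=
  subshift S /\
  exists (B : finType) (T : set (config B)) (f : config B -> config A),
    sft T /\ factor_code T S f.

Definition mixing_sft (A : finType) (S : set (config A)) : Prop :=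
  sft S /\ strongly_irreducible S.

Definition mixing_sofic (A : finType) (S : set (config A)) : Prop :=
  sofic S /\ strongly_irreducible S.

Definition fiber (A B : finType) (S : set (config A))
    (f : config A -> config B) (y : config B) : set (config A) :=
  S `&` f @^-1` [set y].

Definition finite_to_one (A B : finType) (S : set (config A))
    (T : set (config B)) (f : config A -> config B) : Prop :=
  forall y, T y -> finite_set (fiber S f y).

(* The degree is the minimum cardinality of a fiber over a point of [T]; it is
   meaningful for finite-to-one factor codes on irreducible SFTs. *)
Definition has_degree (A B : finType) (S : set (config A))
    (T : set (config B)) (f : config A -> config B) (d : nat) : Prop :=
  (exists2 y, T y & (fiber S f y #= `I_d)%card) /\
  (forall y, T y -> (`I_d #<= fiber S f y)%card).

Definition almost_invertible (A B : finType) (S : set (config A))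
    (T : set (config B)) (f : config A -> config B) : Prop :=
  has_degree S T f 1%N.

(* Main.v *)
Require Import Defs.
From HB Require Import structures.
From mathcomp Require Import all_boot all_order all_algebra finmap.
From mathcomp Require Import all_classical all_reals all_analysis.
From mathcomp Require Import zify ring lra.
Set Implicit Arguments.
Unset Strict Implicit.
Unset Printing Implicit Defensive.
Import Order.TTheory GRing.Theory Num.Theory numFieldNormedType.Exports.
Local Open Scope classical_set_scope.
Local Open Scope ring_scope.

(** It is enough to find a subshift Z' of marked points over Z which can be coded into X
    so that its image under pi can still be read back: Z' is then embedded in Y through X.

    The code is a block code with markers.  Since X is a strongly irreducible shift of
    finite type, any two of its points can be glued across a gap of fixed length
    ([mixing_sft_glue]); hence X has a periodic point x0, of period p say, and points of X
    can be glued one after the other.  As h(Z) < h(Y), for suitable lengths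
    D = n + constant there are more non-p-periodic words of length n in Y than words of
    length D in Z ([entropy_gap]); here the p-periodic words are at most |AY|^p in number,
    so discarding them is harmless.  A codeword starts with a long stretch of x0, and then
    consists of slots of length D, each containing a lift to X of a non-p-periodic word of
    Y.  In the image under pi a long p-periodic run can only come from the start of a
    codeword, and the place where such a run breaks is therefore a marker that locates
    the codewords exactly.  Inside the codeword the slots carry the information, and
    because one slot has more than nblocks Z D values there is room, for all long
    enough words of Z, for the word itself and for an element of an arbitrary finite set
    Q fixed in advance ([codebook]).  Consequently, if Z' is a subshift whose points carry
    a label in Z and marks at distances between N and 2N, and if a point of Z' is
    determined by its labels, its marks and one element of Q at each mark, then Z' embeds
    as required ([encoding]).

    For the first assertion Z' is the suspension of constant height N over Z, that is
    Z times the cyclic group of order N; it maps to Z with fibers of cardinality N.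

    For the second one, Z' must be a mixing shift of finite type with an almost invertible
    map to Z, so the marks have to be placed as a function of the labels.  The subset
    construction for a presentation of Z gives a deterministic automaton which has
    synchronizing words ([sofic_sync]).  Positive entropy provides a word M ending with
    such a word and avoided by arbitrarily long words of Z ([marker_word]).  The automaton
    is extended by a countdown which places a mark whenever it vanishes; it then starts
    again from N - 1, and it also does so when M is read for the first time after a long
    absence.  Such occurrences of M are far apart, so the distances between the marks
    stay between N and 2N ([cover_marked]), while a word u ending with such an occurrence
    brings every state from which it can be read to the same state ([run_u]).  The bi-infinite runs through the states
    accessible from that one form Z'.  It is a shift of finite type, the return through u
    makes it strongly irreducible ([cover_glue]), determinism makes the map to Z
    finite-to-one ([deterministic_finite]), and a point of Z in which u recurs in the past
    has a single preimage ([cover_degree]). *)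

(** * Topology of the full shift *)

Definition agree (A : finType) (i j : int) (x y : config A) : Prop :=
  forall k : int, i <= k < j -> x k = y k.

Definition shiftn (A : finType) (n : int) (x : config A) : config A :=
  fun i => x (i + n).

Lemma agree_sub (A : finType) (i j i' j' : int) (x y : config A) :
  agree i j x y -> i <= i' -> j' <= j -> agree i' j' x y.
Proof. by move=> h hi hj k hk; apply: h; lia. Qed.

(** The cylinders over the windows around the origin are a base of neighborhoods, so
    that all later topology is expressed by agreement on windows. *)
Lemma nbhs_config (A : finType) (x : config A) (U : set (config A)) :
  nbhs x U <-> exists n : nat, forall y, agree (- n%:Z) n%:Z x y -> U y.
Proof.
split.
- pose F : set_system (config A) :=
    filter_from setT (fun n : nat => [set y | agree (- n%:Z) n%:Z x y]).
  have FF : Filter F.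
    apply: filter_from_filter; first by exists 0%N.
    move=> m n _ _; exists (maxn m n) => // y /= h.
    by split; apply: (agree_sub h); lia.
  have cF : {ptws, F --> x}.
    apply/cvg_sup => t V [B [oB Bx] hW]; case: oB Bx hW => O oO <- Ox hW.
    exists (`|t|.+1)%N => // y /= h; apply: hW => /=.
    suff <- : x t = y t by [].
    apply: h; lia.
  move=> /cF [n _ hn]; exists n => y h; exact: hn.
- case=> n hn.
  have hproj (k : int) : nbhs x [set y : config A | y k = x k].
    exact: (@proj_continuous int (fun=> discrete_topology A) k x _
             (discrete_set1 (x k : discrete_topology A))).
  have hall (s : seq int) : nbhs x [set y : config A | forall k, k \in s -> y k = x k].
    elim: s => [|k s IH]; first by apply: filterS filterT.
    apply: filterS (filterI (hproj k) IH) => y [/= h1 h2] j.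
    by rewrite inE => /orP[/eqP->|/h2].
  apply: filterS (hall [seq k%:Z - n%:Z | k <- iota 0 (n + n)]) => y /= h.
  apply: hn => k hk; symmetry; apply: h.
  apply/mapP; exists (absz (k + n%:Z)%R); last by lia.
  by rewrite mem_iota; lia.
Qed.

Lemma compact_config (A : finType) : compact [set: config A].
Proof.
have -> : [set: config A] = [set f : config A | forall i, [set: discrete_topology A] (f i)].
  by apply/seteqP; split.
apply: (@tychonoff int (fun=> discrete_topology A) (fun=> setT)) => i; apply: finite_compact.
exact: (@finite_finset A).
Qed.

Lemma closed_config (A : finType) (S : set (config A)) :
  closed S <-> forall x, (forall n : nat, exists2 y, S y & agree (- n%:Z) n%:Z x y) -> S x.
Proof.
split=> [cS x hx|h].
- apply: cS => U /nbhs_config[n hn]; have [y Sy hy] := hx n.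
  by exists y; split=> //; exact: hn.
- move=> x clx; apply: h => n.
  have /clx[y [Sy hy]] : nbhs x [set y | agree (- n%:Z) n%:Z x y].
    by apply/nbhs_config; exists n.
  by exists y.
Qed.

(** Compactness in sequential form, as it serves to pass from points satisfying a
    local condition on larger and larger windows to one satisfying it everywhere. *)
Lemma config_limit (A : finType) (u : nat -> config A) :
  exists x, forall n : nat, exists2 m, (n <= m)%N & agree (- n%:Z) n%:Z x (u m).
Proof.
have [x [_ hx]] := @compact_config A (u @ \oo) _ filterT.
exists x => n.
have h1 : (u @ \oo) (u @` [set m | (n <= m)%N]).
  exists n => // m /= hm; by exists m.
have h2 : nbhs x [set y | agree (- n%:Z) n%:Z x y] by apply/nbhs_config; exists n.
by have [y [[m hm <-] hy]] := hx _ _ h1 h2; exists m.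
Qed.

(** * Subshifts, sliding block codes and shifts of finite type *)

Lemma shiftnD (A : finType) (m n : int) (x : config A) :
  shiftn m (shiftn n x) = shiftn (m + n) x.
Proof. by apply/funext => i; rewrite /shiftn addrA. Qed.

Lemma shiftn0 (A : finType) (x : config A) : shiftn 0 x = x.
Proof. by apply/funext => i; rewrite /shiftn addr0. Qed.

Lemma int_sign (n : int) : exists k : nat, n = k%:Z \/ n = - k%:Z.
Proof. exists (absz n); lia. Qed.

Lemma subshift_shiftn (A : finType) (S : set (config A)) (n : int) x :
  subshift S -> S x -> S (shiftn n x).
Proof.
move=> [_ hS].
have fwd y : S y -> S (shiftn 1 y) by move=> Sy; rewrite -hS; exists y.
have bwd y : S y -> S (shiftn (-1) y).
  rewrite -{1}hS => -[z Sz <-].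
  have -> : shiftn (-1) (shift_map z) = z.
    by rewrite -[shift_map z]/(shiftn 1 z) shiftnD addNr shiftn0.
  by [].
have natS (k : nat) y : S y -> S (shiftn k%:Z y) /\ S (shiftn (- k%:Z) y).
  move=> Sy; elim: k => [|k [IH1 IH2]]; first by rewrite oppr0 shiftn0.
  split.
    have -> : k.+1%:Z = 1 + k%:Z :> int by lia.
    by rewrite -shiftnD; exact: fwd.
  have -> : - k.+1%:Z = - 1 - k%:Z :> int by lia.
  by rewrite -shiftnD; exact: bwd.
move=> Sx; have [k [->|->]] := int_sign n; first exact: (natS _ _ Sx).1.
exact: (natS _ _ Sx).2.
Qed.

Lemma subshift_intro (A : finType) (S : set (config A)) :
  (forall x, (forall n : nat, exists2 y, S y & agree (- n%:Z) n%:Z x y) -> S x) ->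
  (forall n x, S x -> S (shiftn n x)) -> subshift S.
Proof.
move=> hc hs; split; first by apply/closed_config.
apply/seteqP; split=> [_ [x Sx <-]|x Sx]; first exact: (hs 1 x Sx).
exists (shiftn (-1) x); first exact: hs.
by rewrite -[LHS]/(shiftn 1 (shiftn (-1) x)) shiftnD subrr shiftn0.
Qed.

Lemma subshift_closed (A : finType) (S : set (config A)) x : subshift S ->
  (forall n : nat, exists2 y, S y & agree (- n%:Z) n%:Z x y) -> S x.
Proof. by move=> [/closed_config h _]; exact: h. Qed.

Lemma size_block (A : finType) (x : config A) i n : size (block x i n) = n.
Proof. by rewrite size_map size_iota. Qed.

Lemma nth_block (A : finType) (a : A) (x : config A) i n k : (k < n)%N ->
  nth a (block x i n) k = x (i + k%:Z).
Proof. by move=> h; rewrite (nth_map 0%N) ?size_iota// nth_iota. Qed.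

Lemma block_eq (A : finType) (x y : config A) i j n :
  block x i n = block y j n <-> forall k : nat, (k < n)%N -> x (i + k%:Z) = y (j + k%:Z).
Proof.
split=> [h k hk|h].
  by rewrite -(nth_block (x i) x i hk) h nth_block.
by apply/eq_in_map => k; rewrite mem_iota => hk; apply: h; lia.
Qed.

Lemma block_agree (A : finType) (x y : config A) i n :
  block x i n = block y i n <-> agree i (i + n%:Z) x y.
Proof.
rewrite block_eq; split=> h k hk; last by apply: h; lia.
have -> : k = i + (absz (k - i))%:Z by lia.
by apply: h; lia.
Qed.

Lemma block_shiftn (A : finType) (x : config A) i m n :
  block (shiftn m x) i n = block x (i + m) n.
Proof. by apply/block_eq => k _; rewrite /shiftn; congr (x _); lia. Qed.

Lemma block_cat (A : finType) (x : config A) i m n :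
  block x i (m + n) = block x i m ++ block x (i + m%:Z) n.
Proof.
rewrite /block iotaD map_cat; congr (_ ++ _).
rewrite add0n -[X in iota X n]addn0 iotaDl -map_comp; apply: eq_map => k /=; congr (x _); lia.
Qed.

Lemma block_rcons (A : finType) (x : config A) i n :
  block x i n.+1 = rcons (block x i n) (x (i + n%:Z)).
Proof. by rewrite -addn1 block_cat -cats1 {2}/block /= addr0. Qed.

Lemma block_lang (A : finType) (S : set (config A)) x i n : S x ->
  language S (block x i n).
Proof. by move=> Sx; exists x => //; exists i; rewrite size_block. Qed.

Lemma lang_block (A : finType) (S : set (config A)) w (i : int) : subshift S ->
  language S w -> exists2 x, S x & w = block x i (size w).
Proof.
move=> hS [x Sx [j hw]]; exists (shiftn (j - i) x); first exact: subshift_shiftn.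
by rewrite block_shiftn; rewrite {1}hw; congr block; lia.
Qed.

Lemma lang_catl (A : finType) (S : set (config A)) u v :
  language S (u ++ v) -> language S u.
Proof.
move=> [x Sx [i]]; rewrite size_cat block_cat => /eqP.
by rewrite eqseq_cat ?size_block// => /andP[/eqP-> _]; exact: block_lang.
Qed.

Lemma lang_catr (A : finType) (S : set (config A)) u v :
  language S (u ++ v) -> language S v.
Proof.
move=> [x Sx [i]]; rewrite size_cat block_cat => /eqP.
by rewrite eqseq_cat ?size_block// => /andP[_ /eqP->]; exact: block_lang.
Qed.

Lemma subshift_lang (A : finType) (S : set (config A)) x : subshift S ->
  (forall n : nat, language S (block x (- n%:Z) (n + n))) -> S x.
Proof.
move=> hS h; apply: (subshift_closed hS) => n.
have [y Sy] := lang_block (- n%:Z) hS (h n).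
rewrite size_block => /block_agree hy; exists y => //.
apply: (agree_sub hy); lia.
Qed.

Lemma lang_extend (A : finType) (S : set (config A)) u n :
  language S u -> exists v, size v = n /\ language S (u ++ v).
Proof.
move=> [x Sx [i hu]]; exists (block x (i + (size u)%:Z) n); split.
  by rewrite size_block.
by rewrite {1}hu -block_cat; exact: block_lang.
Qed.

Lemma code_shiftn (A B : finType) (S : set (config A)) (f : config A -> config B) n x :
  subshift S -> (forall x, S x -> f (shift_map x) = shift_map (f x)) ->
  S x -> f (shiftn n x) = shiftn n (f x).
Proof.
move=> hS hf.
have natS (k : nat) y : S y -> f (shiftn k%:Z y) = shiftn k%:Z (f y).
  elim: k y => [|k IH] y Sy; first by rewrite !shiftn0.
  have -> : k.+1%:Z = k%:Z + 1 :> int by lia.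
  by rewrite -!shiftnD IH; [congr shiftn; exact: hf|exact: subshift_shiftn].
move=> Sx; have [k [->|->]] := int_sign n; first exact: natS.
have := natS k _ (subshift_shiftn (- k%:Z) hS Sx).
rewrite shiftnD subrr shiftn0 => ->.
by rewrite shiftnD addNr shiftn0.
Qed.

Definition local_on (A B : finType) (S : set (config A)) (f : config A -> config B)
    (r : nat) : Prop :=
  forall x y i, S x -> S y -> agree (i - r%:Z) (i + r%:Z + 1) x y -> f x i = f y i.

(** By continuity each point of S has a window which determines the symbol of the
    image at the origin; compactness makes the window uniform. *)
Lemma code_radius (A B : finType) (S : set (config A)) (T : set (config B)) f :
  subshift S -> sliding_block_code S T f ->
  exists r : nat, local_on S f r.
Proof.
move=> hS [cf _ hf].
have cS : compact S.
  rewrite -[S]setTI; apply: compact_closedI; first exact: compact_config.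
  by case: hS.
have /compact_near_coveringP/near_covering_withinP cov := cS.
have := cov nat \oo (fun n x => forall y, S y -> agree (- n%:Z) n%:Z x y -> f x 0 = f y 0).
case.
- move=> x Sx; have h : nbhs (f x) [set y : config B | y 0 = f x 0].
    apply/nbhs_config; exists 1%N => y hy /=; symmetry; apply: hy; lia.
  have /subspace_continuousP/(_ x Sx)/(_ _ h) := cf.
  rewrite /= withinE => -[U /nbhs_config[n hn] hU].
  have hU' y : S y -> agree (- n%:Z) n%:Z x y -> f y 0 = f x 0.
    move=> Sy /hn Uy; have : (U `&` S) y by split.
    by rewrite -hU => -[].
  exists ([set y | agree (- n%:Z) n%:Z x y], [set m | (n <= m)%N]).
    by split; [apply/nbhs_config; exists n|exists n].
  move=> [x' m] /= [ax nm] Sx' y Sy a'; rewrite (hU' _ Sx' ax) (hU' y Sy)// => k hk.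
  by rewrite ax//; apply: a'; lia.
- move=> r _ /(_ r (leqnn r)) hr; exists r => x y i Sx Sy hxy.
  have := hr _ (subshift_shiftn i hS Sx) _ (subshift_shiftn i hS Sy).
  rewrite !(code_shiftn _ hS hf)// /shiftn add0r; apply.
  by move=> k hk; apply: hxy; lia.
Qed.

Lemma local_code (A B : finType) (S : set (config A)) (T : set (config B)) f :
  subshift S -> set_fun S T f -> (forall x, S x -> f (shift_map x) = shift_map (f x)) ->
  (exists r : nat, forall x y, S x -> S y -> agree (- r%:Z) r%:Z x y -> f x 0 = f y 0) ->
  sliding_block_code S T f.
Proof.
move=> hS hf hsh [r hr]; split=> //.
apply/subspace_continuousP => x Sx U /nbhs_config[n hn].
have h y : S y -> agree (- (n + r)%N%:Z) (n + r)%N%:Z x y -> U (f y).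
  move=> Sy hy; apply: hn => k hk.
  have := hr _ _ (subshift_shiftn k hS Sx) (subshift_shiftn k hS Sy).
  rewrite !(code_shiftn _ hS hsh)// /shiftn add0r; apply => j hj; apply: hy; lia.
suff : nbhs x [set y | S y -> U (f y)] by [].
by apply/nbhs_config; exists (n + r)%N => y hy Sy; exact: h.
Qed.

(** A forbidden word which occurs in x is seen in a window of length K, where K
    bounds the lengths of the forbidden words, and would occur in the point that
    agrees with x there. *)
Lemma sft_local (A : finType) (S : set (config A)) : sft S ->
  exists K : nat, forall x,
    (forall i : int, exists2 c, S c & agree i (i + K%:Z) c x) -> S x.
Proof.
move=> [_ [F ->]]; exists (\max_(w <- F) size w)%N => x hx w wF [i hw].
have [c hc ag] := hx i.
apply: (hc w wF); exists i; rewrite {1}hw; apply/block_agree => k hk; symmetry; apply: ag.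
have : (size w <= \max_(w <- F) size w)%N by exact: leq_bigmax_seq.
by move: (\max_(w <- F) size w)%N (size w) hk => M m; lia.
Qed.

(** The forbidden words are the pairs of symbols that violate the relation. *)
Lemma sft_step (A : finType) (ok : A -> A -> Prop) :
  sft [set x : config A | forall i, ok (x i) (x (i + 1))].
Proof.
split.
- apply: subshift_intro => [x hx i|n x hx i]; last first.
    by have := hx (i + n); rewrite /shiftn addrAC.
  have [y hy hxy] := hx (`|i|%N.+2).
  by rewrite !hxy; [exact: hy|lia|lia].
- exists [seq [:: ab.1; ab.2] | ab <- enum {: A * A} & ~~ `[< ok ab.1 ab.2 >]].
  apply/seteqP; split=> x hx.
    move=> w /mapP[[a b]]; rewrite mem_filter /= => /andP[/asboolPn h _] -> [i].
    by rewrite /block /= addr0 => -[ea eb]; apply: h; rewrite ea eb; exact: hx.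
  move=> i; apply: contrapT => h.
  apply: (hx [:: x i; x (i + 1)]); last by exists i; rewrite /block /= addr0.
  apply/mapP; exists (x i, x (i + 1)) => //=.
  by rewrite mem_filter mem_enum andbT; apply/asboolPn.
Qed.

Lemma sft_splice (A : finType) (S : set (config A)) : sft S ->
  exists K : nat, forall x y t, S x -> S y -> agree t (t + K%:Z) x y ->
    S (fun i => if i < t then x i else y i).
Proof.
move=> /sft_local[K hK]; exists K => x y t Sx Sy hxy; apply: hK => i.
have [hi|hi] := ltP i t.
  exists x => // k hk; case: ifPn => // hkt; apply: hxy; lia.
exists y => // k hk; case: ifPn => // hkt; lia.
Qed.

(** Strong irreducibility for points instead of words; it is stronger, since the
    half-lines to the left and to the right are both kept. *)
Definition glueable (A : finType) (S : set (config A)) (g : nat) : Prop :=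
  forall x y (t : int), S x -> S y -> exists z,
    [/\ S z, forall i, i < t -> z i = x i & forall i, t + g%:Z <= i -> z i = y i].

(** The gap between the two K-blocks next to it is filled by strong irreducibility;
    as K-blocks are the memory of the shift, the half-lines can then be spliced on
    both sides. *)
Lemma mixing_sft_glue (A : finType) (S : set (config A)) :
  mixing_sft S -> exists2 g : nat, (0 < g)%N & glueable S g.
Proof.
move=> [sS [g [g0 hg]]]; exists g => // x y t Sx Sy.
have [hS _] := sS; have [K hK] := sft_splice sS.
have [v [sv _ huvw]] := hg _ _ (block_lang (t - K%:Z) K Sx) (block_lang (t + g%:Z) K Sy).
have [z Sz] := lang_block (t - K%:Z) hS huvw.
rewrite !size_cat !size_block sv => /eqP; rewrite block_cat eqseq_cat ?size_block//.
move=> /andP[/eqP/block_agree h1]; rewrite block_cat eqseq_cat ?size_block//.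
move=> /andP[_ /eqP/block_eq h2].
have S1 := hK _ _ (t - K%:Z) Sx Sz h1.
have S2 := hK _ _ (t + g%:Z) S1 Sy.
eexists; split; first apply: S2.
- move=> k hk; rewrite ifF; last by apply/negbTE; lia.
  have := h2 (absz (k - (t + g%:Z))%R).
  have -> : t + g%:Z + (absz (k - (t + g%:Z))%R)%:Z = k by lia.
  have -> : t - K%:Z + K%:Z + g%:Z + (absz (k - (t + g%:Z))%R)%:Z = k by lia.
  by move=> ->//; lia.
- move=> i hi /=; rewrite ifT; last by lia.
  by case: ifPn => // hi'; rewrite h1//; lia.
- by move=> i hi /=; rewrite ifF//; apply/negbTE; lia.
Qed.

Lemma glue_irreducible (A : finType) (S : set (config A)) (g : nat) :
  subshift S -> (0 < g)%N -> glueable S g -> strongly_irreducible S.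
Proof.
move=> hS g0 hg; exists g; split=> // u w /(lang_block 0 hS)[x Sx hu].
move=> /(lang_block ((size u)%:Z + g%:Z) hS)[y Sy hw].
have [z [Sz h1 h2]] := hg x y (size u)%:Z Sx Sy.
exists (block z (size u)%:Z g); split; first by rewrite size_block.
  exact: block_lang.
have -> : u = block z 0 (size u).
  by rewrite {1}hu; apply/block_agree => k hk; rewrite h1//; lia.
have -> : w = block z ((size u)%:Z + g%:Z) (size w).
  by rewrite {1}hw; apply/block_agree => k hk; rewrite h2//; lia.
rewrite size_block -block_cat -[X in block z X _]add0r -block_cat.
exact: block_lang.
Qed.

(** * Entropy and word counts *)

Lemma subadditive_iter (R : realType) (u : nat -> R) (m s q : nat) :
  (forall m n, u (m + n)%N <= u m + u n) -> u (q * m + s)%N <= q%:R * u m + u s.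
Proof.
move=> hu; elim: q => [|q IH]; first by rewrite mul0n add0n mul0r add0r.
rewrite mulSn -addnA; apply: (le_trans (hu _ _)).
by rewrite -natr1 mulrDl mul1r; lra.
Qed.

(** Fekete's subadditive lemma: the limit is the infimum over n > 0, because u (q m
    + s) is at most q u(m) up to a bounded error. *)
Lemma fekete (R : realType) (u : nat -> R) :
  (forall n, 0 <= u n) -> (forall m n, u (m + n)%N <= u m + u n) ->
  cvgn (fun n : nat => n%:R^-1 * u n).
Proof.
move=> u0 hu; pose v n : R := n%:R^-1 * u n.
pose E := [set v n | n in [set n | (0 < n)%N]].
have v0 n : 0 <= v n by rewrite mulr_ge0// invr_ge0.
have lbE : has_lbound E by exists 0 => _ [n _ <-].
have hE : has_inf E by split=> //; exists (v 1%N); exists 1%N.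
apply/cvg_ex; exists (inf E); apply/cvgrPdist_lt => e e0.
have e20 : 0 < e / 2 by rewrite divr_gt0.
have [_ [m /= m0 <-] hm] := inf_adherent e20 hE.
pose C := \sum_(s < m) u s.
have hC s : (s < m)%N -> u s <= C.
  move=> hs; rewrite /C (bigD1 (Ordinal hs))//= lerDl sumr_ge0//.
near=> n.
have n0 : (0 < n)%N by near: n; exists 1%N.
have nC : C / (e / 2) < n%:R by near: n; exact: nbhs_infty_gtr.
have nR : (0 : R) < n%:R by rewrite ltr0n.
have h1 : inf E <= v n by apply: ge_inf => //; exists n.
rewrite -[X in inf E - X]/(v n) ltr_distlC; apply/andP; split; first by lra.
have := subadditive_iter m (n %% m) (n %/ m) hu.
rewrite -divn_eq => h2.
have h3 : u n <= (n %/ m)%N%:R * u m + C by apply: (le_trans h2); rewrite lerD2l hC// ltn_mod.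
have mR : (0 : R) < m%:R by rewrite ltr0n.
have h4 : (n %/ m)%N%:R * u m <= n%:R * v m.
  have -> : n%:R * v m = (n%:R / m%:R) * u m by rewrite /v mulrA.
  by rewrite ler_wpM2r// ler_pdivlMr// -natrM ler_nat leq_divM.
have h5 : C < n%:R * (e / 2) by rewrite -ltr_pdivrMr.
rewrite /v mulrC ltr_pdivrMr//.
apply: (le_lt_trans h3); apply: (@le_lt_trans _ _ (n%:R * v m + C)); first by lra.
have : n%:R * v m <= n%:R * (inf E + e / 2) by rewrite ler_pM2l// ltW.
rewrite mulrDr => h6; rewrite mulrDl; nra.
Unshelve. all: by end_near. Qed.

(** The entropy of S is the growth rate of [nblocks S]; sequences are compared in
    this form, for instance with the constant sequence 1. *)
Definition growth_rate (R : realType) (a : nat -> nat) : \bar R :=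
  limn (fun n : nat => (n%:R^-1%:E * lne (a n)%:R%:E)%E).

Lemma growth_rate_le (R : realType) (a b : nat -> nat) (C : nat) :
  (forall n, 0 < a n)%N -> (forall m n, a (m + n) <= a m * a n)%N ->
  (forall n, 0 < b n)%N -> (forall m n, b (m + n) <= b m * b n)%N ->
  (forall n, a n <= C * b n)%N -> (growth_rate R a <= growth_rate R b)%E.
Proof.
move=> a0 aM b0 bM abC.
have lnR (c : nat -> nat) : (forall n, 0 < c n)%N -> (forall m n, c (m + n) <= c m * c n)%N ->
   cvgn (fun n : nat => n%:R^-1 * ln (c n)%:R : R) /\
   growth_rate R c = (limn (fun n : nat => n%:R^-1 * ln (c n)%:R : R))%:E.
  move=> c0 cM; have cv : cvgn (fun n : nat => n%:R^-1 * ln (c n)%:R : R).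
    apply: fekete => [n|m n]; first by rewrite ln_ge0// ler1n.
    rewrite -lnM ?posrE ?ltr0n//.
    by rewrite ler_ln ?posrE ?mulr_gt0 ?ltr0n// -natrM ler_nat.
  split=> //; rewrite -EFin_lim//; congr (limn _); apply/funext => n.
  by rewrite lne_EFin ?ltr0n.
have [cva ->] := lnR a a0 aM; have [cvb ->] := lnR b b0 bM.
have C0 : (0 < C)%N by case: C abC => // /(_ 0%N); have := a0 0%N; lia.
have cvC : (fun n : nat => n%:R^-1 * ln (C%:R) : R) @ \oo --> 0 * ln (C%:R : R).
  apply: cvgMr_tmp; apply/gtr0_cvgV0; last exact: cvgr_idn.
  by exists 1%N => // n /=; rewrite ltr0n.
have cvbC := cvgD cvb cvC.
rewrite lee_fin; rewrite mul0r addr0 in cvbC.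
apply: (ler_cvg_to cva (cvbC _)); exists 1%N => // n /= n0.
have nR : (0 : R) < n%:R by rewrite ltr0n.
rewrite -[leRHS]/(n%:R^-1 * ln (b n)%:R + n%:R^-1 * ln C%:R) -mulrDr ler_pM2l ?invr_gt0// -lnM ?posrE ?ltr0n//.
by rewrite ler_ln ?posrE ?mulr_gt0 ?ltr0n// -natrM ler_nat mulnC.
Qed.

Lemma nblocks_gt0 (A : finType) (S : set (config A)) n : S !=set0 -> (0 < nblocks S n)%N.
Proof.
move=> [x Sx]; rewrite /nblocks card_gt0; apply/set0Pn.
have h : size (block x 0 n) == n by rewrite size_block.
by exists (Tuple h); rewrite inE; apply/asboolP; exact: block_lang.
Qed.

Lemma nblocks_le (A : finType) (S : set (config A)) n : (nblocks S n <= #|A| ^ n)%N.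
Proof. by rewrite -card_tuple; exact: max_card. Qed.

Lemma nblocksD (A : finType) (S : set (config A)) m n :
  (nblocks S (m + n) <= nblocks S m * nblocks S n)%N.
Proof.
rewrite /nblocks -cardsX.
have sz1 (w : (m + n).-tuple A) : size (take m w) == m by rewrite size_takel// size_tuple; lia.
have sz2 (w : (m + n).-tuple A) : size (drop m w) == n by rewrite size_drop size_tuple; lia.
pose h w := (Tuple (sz1 w), Tuple (sz2 w)).
rewrite -(@card_imset _ _ h); last first.
  move=> u w [] h1 h2; apply: val_inj => /=.
  by rewrite -(cat_take_drop m u) h1 h2 cat_take_drop.
apply: subset_leq_card; apply/fintype.subsetP => _ /imsetP[w +] ->; rewrite !inE => hw.
have {}hw : language S (take m w ++ drop m w) by rewrite cat_take_drop.
by apply/andP; split; apply/asboolP; [exact: lang_catl hw|exact: lang_catr hw].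
Qed.

Lemma entropy_set0 (R : realType) (A : finType) (S : set (config A)) :
  ~ (S !=set0) -> entropy R S = -oo%E.
Proof.
move=> S0; apply: lim_near_cst => //; exists 1%N => // n n0.
have -> : nblocks S n = 0%N.
  apply/eqP; rewrite cards_eq0; apply/eqP/setP => w; rewrite !inE.
  by apply/asboolPn => -[y Sy _]; apply: S0; exists y.
by rewrite le0_lneNy// gt0_muleNy// lte_fin invr_gt0 ltr0n.
Qed.

(** Otherwise nblocks Y n would be bounded by a constant times nblocks Z n, since
    passing from n + c to n costs a factor |A|^c only. The shift by c and the excess
    d make room for the gluing gaps and for discarded words. *)
Lemma entropy_gap (R : realType) (A B : finType) (Z : set (config A)) (Y : set (config B)) :
  Z !=set0 -> (entropy R Z < entropy R Y)%E ->
  forall c d : nat, exists n, (nblocks Z (n + c) + d < nblocks Y n)%N.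
Proof.
move=> Z0 hZY c d; apply: contrapT => /forallNP h.
have [Y0|Y0] := pselect (Y !=set0); last first.
  by move: hZY; rewrite (entropy_set0 R Y0) ltNge leNye.
move: hZY; rewrite ltNge => /negP; apply.
apply: (@growth_rate_le R _ _ (#|A| ^ c + d)%N).
- by move=> n; exact: nblocks_gt0.
- by move=> m n; exact: nblocksD.
- by move=> n; exact: nblocks_gt0.
- by move=> m n; exact: nblocksD.
move=> n; have /negP := h n; rewrite -leqNgt => h1; apply: (leq_trans h1).
have h2 := nblocksD Z n c; have h3 := nblocks_le Z c; have h4 := nblocks_gt0 n Z0.
have h5 : (nblocks Z n * nblocks Z c <= nblocks Z n * #|A| ^ c)%N by rewrite leq_mul2l h3 orbT.
have h6 : (d <= d * nblocks Z n)%N by rewrite leq_pmulr.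
by rewrite mulnDl [(_ ^ c * _)%N]mulnC; apply: leq_add => //; apply: leq_trans h2 _.
Qed.

Lemma entropy_unbounded (R : realType) (A : finType) (Z : set (config A)) :
  (0 < entropy R Z)%E -> Z !=set0 /\ forall c : nat, exists n, (c < nblocks Z n)%N.
Proof.
have one : (growth_rate R (fun=> 1%N) = 0)%E.
  apply: lim_near_cst => //; apply: nearW => n.
  by rewrite lne1 mule0.
rewrite -{1}one => h.
have Z0 : Z !=set0.
  apply: contrapT => Z0; move: h; rewrite one.
  by rewrite (entropy_set0 R Z0).
split=> // c; apply: contrapT => /forallNP hc.
move: h; rewrite ltNge => /negP; apply.
apply: (@growth_rate_le R _ _ c) => //.
- by move=> n; exact: nblocks_gt0.
- by move=> m n; exact: nblocksD.
move=> n; have /negP := hc n; rewrite -leqNgt muln1 //.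
Qed.

(** * Marked codewords in the mixing shift of finite type *)

(** Bernoulli's inequality (1 + 1/al)^k >= 1 + k/al, free of denominators. *)
Lemma bernoulli_nat (al k : nat) : (al ^ k * (al + k) <= al * al.+1 ^ k)%N.
Proof.
elim: k => [|k IH]; first by rewrite !expn0 addn0 mulnC.
rewrite !expnS.
have h : (al.+1 * (al ^ k * (al + k)) <= al.+1 * (al * al.+1 ^ k))%N by rewrite leq_mul2l IH orbT.
rewrite mulnCA; apply: leq_trans h.
move: (al ^ k)%N => X; nia.
Qed.

(** By submultiplicativity a n is at most (a D)^(n/D) up to a constant, and (a D +
    1)^k outgrows any constant times (a D)^k. Here c is the part of a codeword that
    carries no information. *)
Lemma submult_growth (a : nat -> nat) (D c q M : nat) :
  (0 < D)%N -> (0 < a D)%N -> (forall m n, a (m + n) <= a m * a n)%N ->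
  (forall s, s < D -> a s <= M)%N ->
  exists N, forall n, (N <= n)%N -> (q * a n <= (a D).+1 ^ ((n - c) %/ D))%N.
Proof.
move=> D0 aD0 aM hM; set al := a D; pose B := (q * M * al ^ c.+1)%N.
exists (c + D * (al * B))%N => n hn; set k := ((n - c) %/ D)%N.
have hk : (al * B <= k)%N by rewrite /k leq_divRL// mulnC; lia.
have hj : (n %/ D <= k + c.+1)%N.
  have -> : (n %/ D = (n - c + c) %/ D)%N by rewrite subnK//; lia.
  apply: (leq_trans (leq_divDl _ _ _)).
  by have := leq_div c D; rewrite -/k; lia.
have iter j s : (a (j * D + s) <= al ^ j * a s)%N.
  elim: j => [|j IH]; first by rewrite mul0n add0n expn0 mul1n.
  rewrite mulSn -addnA expnS -mulnA; apply: (leq_trans (aM _ _)).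
  by rewrite leq_mul2l IH orbT.
have h1 : (a n <= al ^ (k + c.+1) * M)%N.
  rewrite {1}(divn_eq n D); apply: (leq_trans (iter _ _)).
  by apply: leq_mul; [rewrite leq_pexp2l|apply: hM; rewrite ltn_mod].
have h2 : (q * a n <= B * al ^ k)%N.
  apply: (@leq_trans (q * (al ^ (k + c.+1) * M))%N); first by rewrite leq_mul2l h1 orbT.
  by rewrite expnD /B; apply/eq_leq; ring.
apply: (leq_trans h2); rewrite -(leq_pmul2l aD0) -/al.
apply: leq_trans (bernoulli_nat _ _).
rewrite mulnDr; apply: (@leq_trans (al ^ k * k)%N); last by rewrite leq_addl.
by rewrite mulnA mulnC leq_mul2l hk orbT.
Qed.

Lemma card_inj_in (T T' : finType) (A : {set T}) (d : T') : (#|A| <= #|T'|)%N ->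
  exists h : T -> T', {in A &, injective h}.
Proof.
move=> hA; exists (fun x => nth d (enum T') (index x (enum A))) => x y xA yA /eqP.
have hx z : z \in A -> (index z (enum A) < size (enum A))%N.
  by move=> zA; rewrite index_mem mem_enum.
have hs : (size (enum A) <= size (enum T'))%N by rewrite -!cardE.
rewrite nth_uniq ?enum_uniq ?(leq_trans (hx _ _) hs)// => /eqP h.
have ex := nth_index x (s := enum A) (x := x); have ey := nth_index x (s := enum A) (x := y).
by rewrite -ex ?mem_enum// h ey ?mem_enum.
Qed.

(** A point glued to its own translate repeats a block of length K after p = K + g
    steps; repeating that period is legal because K is the memory. *)
Lemma glue_periodic (A : finType) (S : set (config A)) (g : nat) :
  sft S -> (0 < g)%N -> glueable S g -> S !=set0 ->
  exists (x0 : config A) (p : nat), [/\ S x0, (0 < p)%N & forall i, x0 (i + p%:Z) = x0 i].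
Proof.
move=> sS g0 hg [x Sx]; have [hS _] := sS; have [K hK] := sft_local sS.
pose p := (K + g)%N.
have [z [Sz h1 h2]] := hg x (shiftn (- p%:Z) x) K%:Z Sx (subshift_shiftn _ hS Sx).
have p0 : (0 < p)%N by rewrite /p; lia.
have zp k : 0 <= k < K%:Z -> z (k + p%:Z) = z k.
  move=> hk; rewrite (h1 k) ?(h2 (k + p%:Z)); [|rewrite /p; lia|lia].
  by rewrite /shiftn addrK.
exists (fun i => z (i %% p%:Z)%Z), p; split=> //; last by move=> i; rewrite modzDr.
apply: hK => i; exists (shiftn (- (i - (i %% p)%Z)) z); first exact: subshift_shiftn.
move=> k hk; rewrite /shiftn.
have hi1 : 0 <= (i %% p)%Z by rewrite modz_ge0//; lia.
have hi2 : (i %% p)%Z < p%:Z by rewrite ltz_pmod//; lia.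
have e : (k %% p)%Z = ((k - i + (i %% p)%Z) %% p)%Z.
  by rewrite modzDmr subrK.
rewrite e {e}; move: (i %% p)%Z hi1 hi2 => m m0 mp.
have [h|h] := ltP (k - i + m) p%:Z.
  rewrite modz_small; last by apply/andP; split; lia.
  by congr z; lia.
have -> : k - i + m = (k - i + m - p%:Z) + p%:Z by lia.
rewrite modzDr modz_small; last by apply/andP; split; lia.
rewrite -(zp (k - i + m - p%:Z)); last by lia.
by congr z; lia.
Qed.

Lemma glue_chain (A : finType) (S : set (config A)) (g D : nat) :
  glueable S g -> forall (k : nat) (xi : nat -> config A) (c : config A) (t : int),
  S c -> (forall s, S (xi s)) ->
  exists c', [/\ S c', forall i, i < t -> c' i = c i
    & forall s, (s < k)%N -> forall i, t + (s * D + g)%N%:Z <= i < t + (s.+1 * D)%N%:Z ->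
      c' i = xi s i].
Proof.
move=> hg k xi c t Sc Sxi; elim: k => [|k [c1 [S1 h1 h2]]]; first by exists c.
have [c2 [S2 h3 h4]] := hg c1 (xi k) (t + (k * D)%N%:Z) S1 (Sxi k).
exists c2; split=> // [i hi|s hs i hi].
  by rewrite h3 ?h1//; lia.
have [e|hsk] := eqVneq s k; first by subst s; apply: h4; lia.
have sk : (s < k)%N by lia.
rewrite h3; first by apply: (h2 s).
have : (s.+1 * D <= k * D)%N by rewrite leq_mul2r sk orbT.
lia.
Qed.

(** Periodic means that symbols at distance p agree; a word of length at most p
    satisfies this vacuously. *)
Definition periodic_word (A : eqType) (p n : nat) (y : n.-tuple A) :=
  [forall i : 'I_n, forall j : 'I_n, (j == i + p :> nat)%N ==> (tnth y i == tnth y j)].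

Lemma card_periodic (A : finType) (a : A) (p n : nat) : (0 < p)%N ->
  (#|[set y : n.-tuple A | periodic_word p y]%SET| <= #|A| ^ p)%N.
Proof.
move=> p0.
pose h (y : n.-tuple A) := [tuple nth a y i | i < p].
rewrite -card_tuple -(@card_in_imset _ _ h) ?max_card// => y y'.
rewrite !finset.inE => hy hy' e; apply: eq_from_tnth.
suff hh m : forall i : 'I_n, (i < m)%N -> tnth y i = tnth y' i.
  by move=> i; apply: (hh i.+1).
elim: m => // m IH i; rewrite ltnS => im.
have [ip|ip] := ltnP i p.
  have := congr1 (fun t => tnth t (Ordinal ip)) e.
  by rewrite !tnth_mktuple /= -!tnth_nth.
have hi : (i - p < n)%N by have := ltn_ord i; lia.
have ei : (i == Ordinal hi + p :> nat)%N by rewrite /= subnK.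
move/forallP/(_ (Ordinal hi))/forallP/(_ i)/implyP/(_ ei)/eqP : hy => <-.
move/forallP/(_ (Ordinal hi))/forallP/(_ i)/implyP/(_ ei)/eqP : hy' => <-.
by apply: IH => /=; lia.
Qed.

(** Counting turned into a code: a pair of an element of Q and a word of length n is
    sent to the values of k n slots, each in W. *)
Lemma injective_encoding (A Q T : finType) (Z : set (config A)) (k : nat -> nat)
    (W : {set T}) (n0 : nat) :
  Z !=set0 -> W != finset.set0 ->
  (forall n, (n0 <= n)%N -> (#|Q| * nblocks Z n <= #|W| ^ k n)%N) ->
  exists enc : Q -> seq A -> nat -> T,
    (forall q w s, enc q w s \in W) /\
    (forall q w q' w', language Z w -> language Z w' -> (n0 <= size w)%N ->
      size w = size w' -> (forall s, (s < k (size w))%N -> enc q w s = enc q' w' s) ->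
      q = q' /\ w = w').
Proof.
move=> [z Zz] /finset.set0Pn[d dW] hc.
pose Wt := {y : T | y \in W}; pose dt : Wt := exist _ d dW.
pose D n := finset.setX [set: Q]%SET [set w : n.-tuple A | `[< language Z w >]]%SET.
have hex n : exists h : Q * n.-tuple A -> {ffun 'I_(k n) -> Wt},
    (n0 <= n)%N -> {in D n &, injective h}.
  have [hn|hn] := leqP n0 n; last by exists (fun=> [ffun=> dt]); lia.
  have [|h hh] := @card_inj_in _ {ffun 'I_(k n) -> Wt} (D n) [ffun=> dt].
    rewrite /D cardsX cardsT card_ffun card_ord.
    by apply: leq_trans (hc n hn) _; rewrite /Wt card_sig.
  by exists h.
pose h n := projT1 (cid (hex n)).
have hh n : (n0 <= n)%N -> {in D n &, injective (h n)} := projT2 (cid (hex n)).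
pose tup n (w : seq A) : n.-tuple A := insubd [tuple of nseq n (z 0)] w.
exists (fun q w s => val (odflt dt (omap (h (size w) (q, tup (size w) w)) (insub s)))).
split=> [q w s|q w q' w' lw lw' hw hs e]; first exact: valP.
have tw n (v : seq A) : size v = n -> tup n v = v :> seq A.
  by move=> hv; rewrite val_insubd hv eqxx.
move: e; rewrite -hs; set n := size w => e.
have : h n (q, tup n w) = h n (q', tup n w').
  by apply/ffunP => i; apply: val_inj; have := e i (ltn_ord i); rewrite valK.
have mem p v : language Z v -> size v = n -> (p, tup n v) \in D n.
  by move=> lv sv; rewrite finset.inE /= !finset.inE /=; apply/asboolP; rewrite tw.
move/(hh n hw _ _ (mem q w lw erefl) (mem q' w' lw' (esym hs))) => [[->]].
by move/(congr1 val); rewrite /= !tw.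
Qed.

(** The common beginning of all codewords is the point x1 on the left of H. Its
    image is p-periodic up to e, and breaks the period at e for the first time; L is
    the length of a run that counts as a marker, and r the radius of pi. *)
Record header (A B : finType) (pi : config A -> config B) (r : nat) (x1 : config A)
    (a H p L e : nat) : Prop := Header {
  header_p : (0 < p <= L)%N;
  header_a : (2 * r + p < a)%N;
  header_e : (L + r <= e)%N;
  header_H : (a <= H)%N /\ (e + r < H)%N;
  header_periodic : forall i : int, i < e%:Z -> pi x1 i = pi x1 (i - p%:Z);
  header_break : pi x1 e%:Z <> pi x1 (e%:Z - p%:Z) }.

(** A codeword of length n is stored as a whole point of X, so that gluing and pi
    apply to it directly. The tail, of length a, agrees with the beginning of the
    next codeword; that makes concatenations legal. The last field says that between
    two markers every window of length L breaks the period. *)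
Record codeword (A B : finType) (S : set (config A)) (pi : config A -> config B) (r : nat)
    (x1 : config A) (a H p L e : nat) (n : nat) (c : config A) : Prop := Codeword {
  codeword_in : S c;
  codeword_head : forall i : int, i < H%:Z -> c i = x1 i;
  codeword_tail : forall i : int, n%:Z <= i < n%:Z + a%:Z -> c i = x1 (i - n%:Z);
  codeword_nonperiodic : forall s : int, e%:Z - p%:Z < s -> s + L%:Z <= n%:Z + r%:Z + p%:Z ->
    exists i : int, [/\ s <= i, i + p%:Z < s + L%:Z & pi c i <> pi c (i + p%:Z)] }.

Lemma codebook (R : realType) (AX AY AZ : finType) (X : set (config AX))
    (Y : set (config AY)) (Z : set (config AZ)) (pi : config AX -> config AY) (r K0 : nat) :
  mixing_sft X -> factor_code X Y pi -> local_on X pi r ->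
  subshift Y -> subshift Z -> Z !=set0 ->
  (entropy R Z < entropy R Y)%E ->
  exists x1 a H p L e, [/\ (K0 <= a)%N, X x1, header pi r x1 a H p L e &
    forall Q : finType, exists N, (H <= N)%N /\ exists code : Q -> seq AZ -> config AX,
      (forall q w, language Z w -> (N <= size w)%N ->
         codeword X pi r x1 a H p L e (size w) (code q w)) /\
      (forall q w q' w', language Z w -> language Z w' -> (N <= size w)%N ->
         size w = size w' ->
         (forall i : int, r%:Z <= i < (size w)%:Z + a%:Z - r%:Z ->
            pi (code q w) i = pi (code q' w') i) ->
         q = q' /\ w = w')].
Proof.
move=> mX [cpi spi] hr hY hZ Z0 hent; have [sX _] := mX; have [hX _] := sX.
have [g g0 hg] := mixing_sft_glue mX.
have Y0 : Y !=set0.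
  by apply: contrapT => /(entropy_set0 R) e; move: hent; rewrite e ltNge leNye.
have X0 : X !=set0 by have [y /spi[x Xx _]] := Y0; exists x.
have [x0 [p [Sx0 p0 hp]]] := glue_periodic sX g0 hg X0.
have [yY _] := Y0; pose aY := yY 0.
pose c0 := (g + 2 * r)%N.
have [n0 hn0] := entropy_gap Z0 hent c0 (#|AY| ^ p).
pose D := (n0 + c0)%N.
pose W := [set y : n0.-tuple AY | `[< language Y y >] & ~~ periodic_word p y]%SET.
(* The excess |AY|^p in the choice of n0 pays for the p-periodic words. *)
have cW : (nblocks Z D < #|W|)%N.
  have := card_periodic aY n0 p0.
  pose P := [set y : n0.-tuple AY | periodic_word p y]%SET.
  have : (nblocks Y n0 <= #|W :|: P|)%N.
    apply: subset_leq_card; apply/fintype.subsetP => y; rewrite !finset.inE => ->.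
    by rewrite andTb orNb.
  by have := (leq_card_setU W P).1; rewrite -/P; move: hn0; rewrite -/D; lia.
have pish n x : X x -> pi (shiftn n x) = shiftn n (pi x).
  by apply: code_shiftn => //; case: cpi.
have [lift hlift] : exists lift : n0.-tuple AY -> config AX, forall y, y \in W ->
    X (lift y) /\ forall k : 'I_n0, pi (lift y) k%:Z = tnth y k.
  suff h y : exists x, y \in W -> X x /\ forall k : 'I_n0, pi x k%:Z = tnth y k.
    by have [lift] := choice h; exists lift.
  have [yW|] := boolP (y \in W); last by exists x0.
  move: (yW); rewrite finset.inE => /andP[/asboolP/(lang_block 0 hY)[y' Yy' ey] _].
  have [x Xx exy] := spi _ Yy'; exists x => _; split=> // k.
  by rewrite exy (tnth_nth (y' 0)) ey size_tuple nth_block.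
have Wnp y : y \in W -> exists i j : 'I_n0, (j = i + p :> nat)%N /\ tnth y i != tnth y j.
  rewrite finset.inE => /andP[_ /forallPn[i /forallPn[j]]].
  by rewrite negb_imply => /andP[/eqP ? ?]; exists i, j.
have [b0 b0W] : exists b0, b0 \in W.
  by apply/finset.set0Pn; rewrite -card_gt0; lia.
(* A window of length L that starts after the header contains a whole slot, even if
   it reaches into the next header by r + p, hence a pair of symbols that breaks the
   period. *)
pose L := (2 * D + g + 2 * r + 2 * p)%N.
pose a := (K0 + L + 2 * r)%N.
pose H := (a + D)%N.
(* The header is a stretch of x0 of length a followed by one slot with a fixed word
   b0, which forces the period to break at the same place in all codewords. *)
have [x1 [Sx1 h1l h1r]] := hg x0 (shiftn (- (a + g + r)%N%:Z) (lift b0)) a%:Z Sx0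
  (subshift_shiftn _ hX (hlift _ b0W).1).
have per0 i : pi x0 i = pi x0 (i - p%:Z).
  have e : shiftn p%:Z x0 = x0 by apply/funext => k; exact: hp.
  have := congr1 (fun f : config AY => f (i - p%:Z)) (pish p%:Z x0 Sx0).
  by rewrite e {1}/shiftn subrK => ->.
have pi0 i : i < a%:Z - r%:Z -> pi x1 i = pi x0 i.
  by move=> hi; apply: hr => // k hk; rewrite h1l//; lia.
have per1 i : i < a%:Z - r%:Z -> pi x1 i = pi x1 (i - p%:Z).
  by move=> hi; rewrite !pi0 -?per0//; lia.
have slot0 (k : 'I_n0) : pi x1 ((a + g + r)%N%:Z + k%:Z) = tnth b0 k.
  rewrite -(hlift _ b0W).2; transitivity (pi (shiftn (- (a + g + r)%N%:Z) (lift b0))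
     ((a + g + r)%N%:Z + k%:Z)); last first.
    by rewrite (pish _ _ (hlift _ b0W).1) /shiftn; congr (pi _ _); lia.
  apply: hr => //; first exact: subshift_shiftn hX (hlift _ b0W).1.
  by move=> m hm; apply: h1r; lia.
have [i0 [j0 [ij0 tij0]]] := Wnp _ b0W.
have hex : exists m : nat, pi x1 m%:Z != pi x1 (m%:Z - p%:Z).
  exists (a + g + r + j0)%N.
  have -> : (a + g + r + j0)%N%:Z = (a + g + r)%N%:Z + j0%:Z by lia.
  have -> : (a + g + r)%N%:Z + j0%:Z - p%:Z = (a + g + r)%N%:Z + i0%:Z by lia.
  by rewrite !slot0 eq_sym.
case: (ex_minnP hex) => e /eqP he hmin.
have ej0 : (e <= a + g + r + j0)%N.
  apply: hmin.
  have -> : (a + g + r + j0)%N%:Z = (a + g + r)%N%:Z + j0%:Z by lia.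
  have -> : (a + g + r)%N%:Z + j0%:Z - p%:Z = (a + g + r)%N%:Z + i0%:Z by lia.
  by rewrite !slot0 eq_sym.
have ea : (a <= e + r)%N.
  rewrite leqNgt; apply/negP => h; apply: he; apply: per1; lia.
have lj0 := ltn_ord j0.
exists x1, a, H, p, L, e; split=> //; first by rewrite /a; lia.
  split=> //; first by rewrite /L; lia.
  - by rewrite /a /L; lia.
  - by move: ea; rewrite /a; lia.
  - by rewrite /H /D /c0; split; lia.
  - move=> i hi; have [h|h] := ltP i (a%:Z - r%:Z); first exact: per1.
    have [m em] : exists m : nat, i = m%:Z by exists (absz i); lia.
    apply: contrapT => /eqP hne; rewrite em in hne hi.
    by have := hmin _ hne; lia.
move=> Q.
(* The number of slots left after the header and before the final gap of length g. *)
pose k n := ((n - (g + a + D)) %/ D)%N.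
have D0 : (0 < D)%N by rewrite /D /c0; lia.
have [z Zz] := Z0.
have AZ0 : (0 < #|AZ|)%N by apply/card_gt0P; exists (z 0).
have [N1 hN1] : exists N, forall n, (N <= n)%N ->
    (#|Q| * nblocks Z n <= (nblocks Z D).+1 ^ k n)%N.
  apply: (@submult_growth (nblocks Z) D (g + a + D) #|Q| (#|AZ| ^ D)) => //.
  - exact: nblocks_gt0.
  - by move=> m n; exact: nblocksD.
  - move=> s sD; apply: (leq_trans (nblocks_le Z s)); rewrite leq_pexp2l//; lia.
have [|n hn|enc [encW encI]] := @injective_encoding AZ Q _ Z k W N1 Z0.
- by rewrite -card_gt0; lia.
- by apply: leq_trans (hN1 n hn) _; case: (k n) => // k'; rewrite leq_exp2r.
pose N := (N1 + H + g + a + D)%N.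
(* A slot starts with the gluing gap, and pi is determined only at distance r from
   the borders of its glued part; hence the offset g + r of the word in the slot. *)
pose xi q w s := shiftn (- (H + s * D + g + r)%N%:Z) (lift (enc q w s)).
have Sxi q w s : X (xi q w s) by apply: subshift_shiftn => //; exact: (hlift _ (encW q w s)).1.
pose spec q w c := (N <= size w)%N -> [/\ X c, forall i, i < H%:Z -> c i = x1 i,
  forall i, (size w)%:Z <= i -> c i = x0 (i - (size w)%:Z) &
  forall s, (s < k (size w))%N -> forall i, H%:Z + (s * D + g)%N%:Z <= i < H%:Z + (s.+1 * D)%N%:Z ->
    c i = xi q w s i].
have kD n s : (N <= n)%N -> (s < k n)%N -> (H + s.+1 * D + g <= n)%N.
  move=> hn hs; have : (s.+1 * D <= k n * D)%N by rewrite leq_mul2r hs orbT.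
  by have := leq_divM (n - (g + a + D)) D; rewrite -/(k n) /H; move: hn; rewrite /N /H; lia.
have [code hcode] : exists code : Q -> seq AZ -> config AX, forall q w, spec q w (code q w).
  suff h (qw : Q * seq AZ) : exists c, spec qw.1 qw.2 c.
    have [f hf] := choice h; exists (fun q w => f (q, w)) => q w; exact: (hf (q, w)).
  case: qw => q w /=; set n := size w.
  have [hn|hn] := leqP N n; last by exists x1 => h; move: hn; rewrite ltnNge h.
  have [c [Sc hc1 hc2]] := glue_chain D hg (k n) H%:Z Sx1 (Sxi q w).
  have [c' [Sc' hc3 hc4]] := hg c (shiftn (- n%:Z) x0) (n%:Z - g%:Z) Sc
    (subshift_shiftn _ hX Sx0).
  exists c' => _; split=> //.
  - by move=> i hi; rewrite hc3 ?hc1//; move: hn; rewrite /N; lia.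
  - by move=> i hi; rewrite hc4//; rewrite -/n in hi *; lia.
  - move=> s hs i hi; rewrite hc3; first exact: hc2.
    by have := kD _ _ hn hs; lia.
have slot q w s (j : 'I_n0) : (N <= size w)%N -> (s < k (size w))%N ->
    pi (code q w) ((H + s * D + g + r)%N%:Z + j%:Z) = tnth (enc q w s) j.
  move=> hn hs; have [Sc _ _ hc] := hcode q w hn.
  rewrite -(hlift _ (encW q w s)).2; transitivity (pi (xi q w s)
     ((H + s * D + g + r)%N%:Z + j%:Z)); last first.
    by rewrite (pish _ _ (hlift _ (encW q w s)).1) /shiftn; congr (pi _ _); lia.
  apply: hr => // m hm; apply: (hc s hs).
  by have := ltn_ord j; rewrite mulSn {2}/D /c0; lia.
have headpi q w i : (N <= size w)%N -> i < H%:Z - r%:Z -> pi (code q w) i = pi x1 i.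
  move=> hn hi; have [Sc hc _ _] := hcode q w hn; apply: hr => // m hm; apply: hc; lia.
exists N; split; first by rewrite /N; lia.
exists code; split.
- move=> q w lw hn; have [Sc hc1 hc2 hc3] := hcode q w hn; split=> //.
    by move=> i hi; rewrite hc2 ?h1l//; lia.
  (* A window that starts in the header contains the slot of b0; one that starts
     later contains the first payload slot after its start. *)
  move=> s hs hsL; have [sa|sa] := leP s a%:Z.
    exists ((a + g + r)%N%:Z + i0%:Z); split.
    + lia.
    + by rewrite /L; move: ea; rewrite /a /D /c0; lia.
    + have -> : (a + g + r)%N%:Z + i0%:Z + p%:Z = (a + g + r)%N%:Z + j0%:Z by lia.
      have e1 : (H = a + n0 + g + 2 * r)%N by rewrite /H /D /c0; lia.
      rewrite !headpi//; [|lia|lia].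
      by rewrite !slot0; apply/eqP.
  pose m := absz (s - a%:Z - 1)%R; pose s0 := (m %/ D)%N.
  have em : s = a%:Z + 1 + m%:Z by rewrite /m; lia.
  have hm1 : (s0 * D <= m)%N by exact: leq_divM.
  have hm2 : (m < s0.+1 * D)%N by rewrite /s0 ltn_ceil.
  have hk : (s0 < k (size w))%N.
    rewrite /k leq_divRL// mulSn; move: hsL; rewrite em /L; lia.
  have [i [j [eij tij]]] := Wnp _ (encW q w s0).
  exists ((H + s0 * D + g + r)%N%:Z + i%:Z); split.
  + by rewrite em /H; move: hm2; rewrite mulSn; lia.
  + by have := ltn_ord j; rewrite em /H /L; move: hm2 hm1; rewrite /D /c0; lia.
  + have -> : (H + s0 * D + g + r)%N%:Z + i%:Z + p%:Z = (H + s0 * D + g + r)%N%:Z + j%:Z by lia.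
    by rewrite !slot//; apply/eqP.
- move=> q w q' w' lw lw' hn hs he'; apply: encI => //; first by move: hn; rewrite /N; lia.
  move=> s hsk; apply: eq_from_tnth => j.
  rewrite -!slot -?hs//; apply: he'.
  have := kD _ _ hn hsk; have := ltn_ord j; rewrite mulSn {2}/D /c0; lia.
Qed.

(** * Encoding a marked subshift *)

(** The marker as seen in Y: a run of period p and length L that breaks at t. *)
Definition periodic_run_ends (B : Type) (p : nat) (L : nat) (y : int -> B) (t : int) : Prop :=
  (forall i : int, t - L%:Z <= i -> i + p%:Z < t -> y i = y (i + p%:Z)) /\ y t <> y (t - p%:Z).

Definition gap_around (A : finType) (mark : pred A) (x : config A) (i u v : int) : Prop :=
  [/\ mark (x u), mark (x v), u <= i < v & forall k : int, u < k < v -> ~~ mark (x k)].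

(** The upper bound says that any window of length 2N contains a mark. *)
Definition well_marked (A : finType) (mark : pred A) (N : nat) (S : set (config A)) : Prop :=
  forall x, S x ->
    (forall i j : int, i < j -> mark (x i) -> mark (x j) -> i + N%:Z <= j) /\
    (forall i : int, exists2 j : int, i <= j < i + (2 * N)%N%:Z & mark (x j)).

Lemma gap_exists (A : finType) (mark : pred A) N S (x : config A) i :
  well_marked mark N S -> S x ->
  exists u v, [/\ gap_around mark x i u v, u + N%:Z <= v, i - (2 * N)%N%:Z < u &
    v <= i + (2 * N)%N%:Z].
Proof.
move=> hm Sx; have [h1 h2] := hm x Sx.
have [j hj mj] := h2 (i + 1); have [j' hj' mj'] := h2 (i + 1 - (2 * N)%N%:Z).
have ex1 : exists m : nat, mark (x (i + 1 + m%:Z)).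
  by exists (absz (j - i - 1)%R); have -> : i + 1 + (absz (j - i - 1)%R)%:Z = j by lia.
have ex2 : exists m : nat, mark (x (i - m%:Z)).
  by exists (absz (i - j')%R); have -> : i - (absz (i - j')%R)%:Z = j' by lia.
case: (ex_minnP ex1) => m m1 m2; case: (ex_minnP ex2) => n n1 n2.
have hn : (n <= absz (i - j')%R)%N.
  by apply: n2; have -> : i - (absz (i - j')%R)%:Z = j' by lia.
have hmm : (m <= absz (j - i - 1)%R)%N.
  by apply: m2; have -> : i + 1 + (absz (j - i - 1)%R)%:Z = j by lia.
exists (i - n%:Z), (i + 1 + m%:Z); split; [split=> //|apply: h1 => //|..]; try lia.
move=> k hk; apply/negP => mk; have [ki|ki] := leP k i.
  have := n2 (absz (i - k)%R); have -> : i - (absz (i - k)%R)%:Z = k by lia.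
  by move=> /(_ mk); lia.
have := m2 (absz (k - i - 1)%R); have -> : i + 1 + (absz (k - i - 1)%R)%:Z = k by lia.
by move=> /(_ mk); lia.
Qed.

Lemma gap_unique (A : finType) (mark : pred A) (x : config A) i u v u' v' :
  gap_around mark x i u v -> gap_around mark x i u' v' -> u = u' /\ v = v'.
Proof.
move=> [mu mv h1 h2] [mu' mv' h1' h2']; split.
  have [] := ltgtP u u' => // h.
    by have := h2 u'; rewrite mu'; move=> /(_ ltac:(lia)).
  by have := h2' u; rewrite mu; move=> /(_ ltac:(lia)).
have [] := ltgtP v v' => // h.
  by have := h2' v; rewrite mv; move=> /(_ ltac:(lia)).
by have := h2 v'; rewrite mv'; move=> /(_ ltac:(lia)).
Qed.

Lemma gap_move (A : finType) (mark : pred A) (x : config A) i j u v :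
  gap_around mark x i u v -> u <= j < v -> gap_around mark x j u v.
Proof. by move=> [mu mv h1 h2]. Qed.

Section Encoding.
Variables (AX AY AZ A Q : finType) (X : set (config AX)) (Z : set (config AZ)).
Variables (pi : config AX -> config AY) (T : set (config AY)) (r : nat).
Variables (x1 : config AX) (a H p L e N K : nat) (code : Q -> seq AZ -> config AX).
Variables (S : set (config A)) (lab : A -> AZ) (st : A -> Q) (mark : pred A).
Hypothesis hX : subshift X.
Hypothesis pisl : sliding_block_code X T pi.
Hypothesis hr : local_on X pi r.
Hypothesis X_local : forall x,
    (forall i : int, exists2 c, X c & agree i (i + K%:Z) c x) -> X x.
Hypothesis hKa : (K <= a)%N.
Hypothesis Sx1 : X x1.
Hypothesis hhead : header pi r x1 a H p L e.
Hypothesis hHN : (H <= N)%N.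
Hypothesis hcode : forall q w, language Z w -> (N <= size w)%N ->
  codeword X pi r x1 a H p L e (size w) (code q w).
Hypothesis hcodeI : forall q w q' w', language Z w -> language Z w' -> (N <= size w)%N ->
  size w = size w' ->
  (forall i : int, r%:Z <= i < (size w)%:Z + a%:Z - r%:Z ->
     pi (code q w) i = pi (code q' w') i) ->
  q = q' /\ w = w'.
Hypothesis hS : subshift S.
Hypothesis hlab : forall x, S x -> Z (lab \o x : config AZ).
Hypothesis hmark : well_marked mark N S.

Definition segment_code (x : config A) (u v : int) : config AX :=
  code (st (x u)) (block (lab \o x : config AZ) u (absz (v - u))).

(** The default value of the choice is used only at points without marks on both
    sides. *)
Definition encode (x : config A) : config AX := fun i =>
  let uv := xget (0, 0) [set uv : int * int | gap_around mark x i uv.1 uv.2] in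
  segment_code x uv.1 uv.2 (i - uv.1).

Lemma encodeE x i u v : gap_around mark x i u v -> encode x i = segment_code x u v (i - u).
Proof.
move=> h; rewrite /encode.
have := @xgetPex _ (0, 0) [set uv : int * int | gap_around mark x i uv.1 uv.2].
case: (xget _ _) => u' v' /= /(_ _)/(gap_unique h)[]; first by exists (u, v).
by move=> -> ->.
Qed.

Lemma segment_codeword x u v i : S x -> gap_around mark x i u v ->
  codeword X pi r x1 a H p L e (absz (v - u)) (segment_code x u v).
Proof.
move=> Sx hg; have [h1 _] := hmark Sx; have [mu mv huv _] := hg.
have hN : u + N%:Z <= v by apply: h1 => //; lia.
have := @hcode (st (x u)) (block (lab \o x : config AZ) u (absz (v - u))).
rewrite size_block; apply; last by lia.
exact: block_lang (hlab Sx).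
Qed.

(** On the first a symbols after v the next codeword has taken over, but there it
    agrees with the tail of the previous one. *)
Lemma encode_seg x u v i : S x -> gap_around mark x u u v -> u <= i < v + a%:Z ->
  encode x i = segment_code x u v (i - u).
Proof.
move=> Sx hg hi; have [iv|iv] := ltP i v.
  by apply: encodeE; apply: gap_move hg _; lia.
have [u' [v' [hg' hN _ _]]] := gap_exists v hmark Sx.
have [_ mv huv hno] := hg; have [mu' _ hu' hno'] := hg'.
have eu : u' = v.
  have [] := ltgtP u' v => // h; last by lia.
  by have := hno' v; rewrite mv => /(_ ltac:(lia)).
subst u'; have [haH _] := header_H hhead.
rewrite (@encodeE x i v v'); last by apply: gap_move hg' _; lia.
rewrite (codeword_head (segment_codeword Sx hg')); last by lia.
rewrite (codeword_tail (segment_codeword Sx hg)); last by lia.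
by congr x1; lia.
Qed.

Lemma encode_in x : S x -> X (encode x).
Proof.
move=> Sx; apply: X_local => i; have [u [v [hg _ _ _]]] := gap_exists i hmark Sx.
have [_ _ hi _] := hg.
exists (shiftn (- u) (segment_code x u v)).
  by apply: subshift_shiftn => //; exact: codeword_in (segment_codeword Sx hg).
move=> k hk; rewrite (@encode_seg x u v)//; first by apply: gap_move hg _; lia.
lia.
Qed.

Lemma pi_encode_seg x u v i : S x -> gap_around mark x u u v ->
  u + r%:Z <= i < v + a%:Z - r%:Z -> pi (encode x) i = pi (segment_code x u v) (i - u).
Proof.
move=> Sx hg hi.
have Sc := codeword_in (segment_codeword Sx hg).
have [_ _ hsh] := pisl.
rewrite -[RHS]/(shiftn (- u) (pi (segment_code x u v)) i) -(code_shiftn _ hX hsh)//.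
apply: hr => //; [exact: encode_in|exact: subshift_shiftn|].
by move=> k hk; rewrite (@encode_seg x u v)//; lia.
Qed.

Lemma pi_encode_head x u i : S x -> mark (x u) -> r%:Z <= i < H%:Z - r%:Z ->
  pi (encode x) (u + i) = pi x1 i.
Proof.
move=> Sx mu hi; have [u' [v [hg hN _ _]]] := gap_exists u hmark Sx.
have eu : u' = u.
  have [_ _ h h'] := hg; have [] := ltgtP u' u => // hu; last by lia.
  by have := h' u; rewrite mu => /(_ ltac:(lia)).
subst u'; have [haH heH] := header_H hhead.
have cw := segment_codeword Sx hg.
have ha := header_a hhead.
rewrite (pi_encode_seg Sx hg); last by lia.
have -> : u + i - u = i by lia.
apply: hr => //; first exact: codeword_in cw.
by move=> k hk; apply: (codeword_head cw); lia.
Qed.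

Lemma mark_period x t : S x -> mark (x t) -> periodic_run_ends p L (pi (encode x)) (t + e%:Z).
Proof.
move=> Sx mt; have ha := header_a hhead; have [haH heH] := header_H hhead.
have he := header_e hhead; have hp := header_p hhead; split.
  move=> i hi1 hi2; have -> : i = t + (i - t) by lia.
  rewrite pi_encode_head//; last by lia.
  have -> : t + (i - t) + p%:Z = t + (i - t + p%:Z) by lia.
  rewrite pi_encode_head//; last by lia.
  rewrite [RHS](header_periodic hhead); last by lia.
  by rewrite addrK.
rewrite -addrA !pi_encode_head//; [|lia|lia].
exact: header_break hhead.
Qed.

(** Let t lie strictly between consecutive marks u and v. If the run reaches back to
    the header at u, it contains the break of that header; if it ends before the
    header at v, it breaks inside the codeword; and if it ends inside the header at
    v, the period has not yet broken there. *)
Lemma period_mark x t : S x -> periodic_run_ends p L (pi (encode x)) (t + e%:Z) -> mark (x t).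
Proof.
move=> Sx [per brk]; have ha := header_a hhead; have [haH heH] := header_H hhead.
have he := header_e hhead; have hp := header_p hhead.
have [u [v [hg hN _ _]]] := gap_exists t hmark Sx.
have [mu mv /andP[ut tv] _] := hg.
have [->//|neut] := eqVneq t u.
have hg' : gap_around mark x u u v by apply: gap_move hg _; lia.
have cw := segment_codeword Sx hg'; exfalso.
have [sA|sA] := leP (t + e%:Z - L%:Z) (u + (e%:Z - p%:Z)).
  have := per (u + (e%:Z - p%:Z)) sA ltac:(lia).
  rewrite -addrA !pi_encode_head//; [|lia|lia].
  by rewrite subrK => h; apply: (header_break hhead).
have [sB|sB] := leP (t + e%:Z) (v + r%:Z + p%:Z).
  have [|| i [i1 i2 i3]] := codeword_nonperiodic cw (s := t + e%:Z - L%:Z - u); [lia|lia|].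
  apply: i3; have := per (u + i) ltac:(lia) ltac:(lia).
  rewrite !(pi_encode_seg Sx hg'); [|lia|lia].
  have -> : u + i - u = i by lia.
  by have -> : u + i + p%:Z - u = i + p%:Z by lia.
apply: brk.
have [m em] : exists m, t + e%:Z = v + m by exists (t + e%:Z - v); lia.
rewrite em.
rewrite -addrA !pi_encode_head//; [|lia|lia].
by apply: (header_periodic hhead); lia.
Qed.

Lemma encode_sliding : sliding_block_code S X encode.
Proof.
apply: local_code => //; first by move=> x Sx; exact: encode_in.
- move=> x Sx; apply/funext => i.
  have [u [v [[mu mv h1 h2] _ _ _]]] := gap_exists (i + 1) hmark Sx.
  rewrite (@encodeE _ i (u - 1) (v - 1)); last first.
    rewrite /gap_around /shift_map !subrK; split=> //; first by lia.
    by move=> k hk; apply: h2; lia.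
  rewrite {2}/shift_map (@encodeE _ (i + 1) u v)// /segment_code /shift_map subrK.
  have -> : v - 1 - (u - 1) = v - u by lia.
  have -> : i - (u - 1) = i + 1 - u by lia.
  congr (code _ _ _); apply/block_eq => k _ /=; congr (lab (x _)); lia.
- exists (2 * N).+1 => x x' Sx Sx' hxx.
  have [u [v [hg _ hu hv]]] := gap_exists 0 hmark Sx.
  have [mu mv h1 h2] := hg.
  rewrite (encodeE hg) (@encodeE x' 0 u v); last first.
    split; rewrite -?hxx//; try lia.
    by move=> k hk; rewrite -hxx ?h2//; lia.
  rewrite /segment_code hxx; last by lia.
  congr (code _ _ _); apply/block_agree => k hk /=; rewrite hxx//; lia.
Qed.

Hypothesis hdet : forall x y, S x -> S y -> (forall i, lab (x i) = lab (y i)) ->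
  (forall i, mark (x i) = mark (y i)) -> (forall i, mark (x i) -> st (x i) = st (y i)) -> x = y.

(** The marks are recovered as the ends of periodic runs; between two of them, the
    image determines the codeword, hence the labels and the element of Q. *)
Lemma pi_encode_inj : set_inj S (pi \o encode).
Proof.
move=> x y /set_mem Sx /set_mem Sy /= exy.
have em i : mark (x i) = mark (y i).
  by apply/idP/idP => m; apply: period_mark => //; [rewrite -exy|rewrite exy]; exact: mark_period.
have key u v : gap_around mark x u u v ->
    st (x u) = st (y u) /\ forall i, u <= i < v -> lab (x i) = lab (y i).
  move=> hg; have hgy : gap_around mark y u u v.
    by case: hg => *; split; rewrite -?em// => k hk; rewrite -em; auto.
  have [h1 _] := hmark Sx; have [mu mv huv _] := hg.
  have hN : u + N%:Z <= v by apply: h1 => //; lia.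
  have [|||||-> e2] := @hcodeI (st (x u)) (block (lab \o x : config AZ) u (absz (v - u)))
    (st (y u)) (block (lab \o y : config AZ) u (absz (v - u))).
  - exact: block_lang (hlab Sx).
  - exact: block_lang (hlab Sy).
  - by rewrite size_block; lia.
  - by rewrite !size_block.
  - rewrite size_block => i hi.
    have := pi_encode_seg Sx hg (i := u + i) ltac:(lia).
    have := pi_encode_seg Sy hgy (i := u + i) ltac:(lia).
    have -> : u + i - u = i by lia.
    by rewrite /segment_code exy => -> ->.
  split=> // i hi; move/block_agree: e2 => e2; apply: (e2 i); lia.
apply: hdet => // i; last first.
  move=> mi; have [u [v [hg _ _ _]]] := gap_exists i hmark Sx.
  have [_ _ hi hno] := hg; have ei : i = u.
    have [] := ltgtP i u => // h; first by lia.
    by have := hno i; rewrite mi => /(_ ltac:(lia)).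
  by subst i; have [] := key _ _ hg.
have [u [v [hg _ _ _]]] := gap_exists i hmark Sx; have [_ _ hi _] := hg.
by apply: (key u v _).2 => //; apply: gap_move hg _; lia.
Qed.
End Encoding.

(** The set Q comes before N, while the alphabet of S comes after it: the alphabet
    may depend on N, the information stored at a mark must not. *)
Lemma encoding (R : realType) (AX AY AZ : finType) (X : set (config AX))
    (Y : set (config AY)) (Z : set (config AZ)) (pi : config AX -> config AY) (Q : finType) :
  mixing_sft X -> factor_code X Y pi -> subshift Y -> subshift Z -> Z !=set0 ->
  (entropy R Z < entropy R Y)%E ->
  exists2 N : nat, (0 < N)%N & forall (A : finType) (S : set (config A))
    (lab : A -> AZ) (st : A -> Q) (mark : pred A),
    subshift S -> (forall x, S x -> Z (lab \o x : config AZ)) -> well_marked mark N S ->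
    (forall x y, S x -> S y -> (forall i, lab (x i) = lab (y i)) ->
      (forall i, mark (x i) = mark (y i)) -> (forall i, mark (x i) -> st (x i) = st (y i)) ->
      x = y) ->
    exists2 psi, sliding_block_code S X psi & set_inj S (pi \o psi).
Proof.
move=> mX fpi hY hZ Z0 hent; have [sX _] := mX; have [hX _] := sX; have [cpi _] := fpi.
have [r hr] := code_radius hX cpi; have [K hK] := sft_local sX.
have [x1 [a [H [p [L [e [hKa Sx1 hh hcode]]]]]]] :=
  codebook K mX fpi hr hY hZ Z0 hent.
have [N [HN [code [hc1 hc2]]]] := hcode Q.
exists N; first by have [? ?] := header_H hh; lia.
move=> A S lab st mark hS hlab hm hdet; exists (encode code lab st mark).
  exact: (encode_sliding st hX hK hKa hh HN hc1 hS hlab hm).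
exact: (pi_encode_inj hX cpi hr hK hKa Sx1 hh HN hc1 hc2 hlab hm hdet).
Qed.

(** * Arbitrary subshifts: the constant-height suspension *)

(** Distinct points of F have distinct values of s far enough to the left, since a
    coincidence of s propagates to the right. Hence a finite subset of F injects
    into T, by the value of s at a common position. *)
Lemma deterministic_finite (A T : finType) (F : set (config A)) (s : A -> T) :
  (forall x y i, F x -> F y -> s (x i) = s (y i) -> forall j, i <= j -> x j = y j) ->
  finite_set F.
Proof.
move=> det; apply: contrapT => infF.
have [B BF cB] := infinite_set_fset #|T|.+1 infF.
have sep (l : seq (config A * config A)) : exists j : int, forall p, p \in l ->
    F p.1 -> F p.2 -> p.1 <> p.2 -> s (p.1 j) <> s (p.2 j).
  elim: l => [|[x y] l [j hj]]; first by exists 0.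
  have [[Fx Fy nxy]|h] := pselect [/\ F x, F y & x <> y]; last first.
    exists j => p; rewrite inE => /orP[/eqP->/= Fx Fy nxy|]; last exact: hj.
    by case: h.
  have [i hi] : exists i, x i <> y i.
    by apply: contrapT => /forallNP h; apply: nxy; apply/funext => i; apply: contrapT.
  have mono (j1 j2 : int) u v : F u -> F v -> j1 <= j2 -> s (u j2) <> s (v j2) ->
      s (u j1) <> s (v j1).
    by move=> Fu Fv hj12 h e; apply: h; rewrite (det _ _ _ Fu Fv e).
  exists (Num.min i j) => p; rewrite inE => /orP[/eqP->/= _ _ _ e|pl F1 F2 n].
    by apply: hi; apply: (det _ _ _ Fx Fy e); lia.
  by apply: (mono _ j) => //; [lia|exact: hj].
have [j hj] := sep [seq (x, y) | x <- B, y <- B].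
have : uniq [seq s (x j) | x <- B].
  rewrite map_inj_in_uniq ?fset_uniq// => x y xB yB e; apply: contrapT => nxy.
  apply: (hj (x, y)) => //=; [exact: allpairs_f|exact: BF|exact: BF].
move/card_uniqP; rewrite size_map => e.
by have := max_card [in [seq s (x j) | x <- B]]; rewrite e => /(leq_trans cB); rewrite ltnn.
Qed.

Lemma one_block_code (A B : finType) (S : set (config A)) (T : set (config B)) (f : A -> B) :
  subshift S -> (forall x, S x -> T (f \o x : config B)) ->
  sliding_block_code S T (fun x => f \o x : config B).
Proof.
move=> hS hf; apply: local_code => //; exists 1%N => x y _ _ h /=.
by rewrite h//; lia.
Qed.

Section Suspension.
Variables (A : finType) (Z : set (config A)) (N : nat).
Hypothesis hZ : subshift Z.

(** The points of Z with a cyclic clock of period N. *)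
Definition suspension : set (config (A * 'I_N)%type) :=
  [set x : config (A * 'I_N)%type | Z (fst \o x : config A) /\ forall i, (x (i + 1)).2 = ordS (x i).2].

Lemma suspension_phase x i (k : nat) : suspension x ->
  (x (i + k%:Z)).2 = (((x i).2 + k) %% N)%N :> nat.
Proof.
move=> [_ h]; elim: k => [|k IH]; first by rewrite addr0 addn0 modn_small.
have -> : i + k.+1%:Z = i + k%:Z + 1 by lia.
by rewrite h /= IH -addn1 modnDml addn1 addnS.
Qed.

Lemma suspension_subshift : subshift suspension.
Proof.
apply: subshift_intro => [x hx|n x [Zx hx]]; last first.
  split; first exact: (subshift_shiftn n hZ Zx).
  by move=> i; have := hx (i + n); rewrite /shiftn addrAC.
split.
  apply: (subshift_closed hZ) => n; have [y [Zy _] hy] := hx n.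
  by exists (fst \o y) => // k hk /=; rewrite hy.
move=> i; have [y [_ h] hxy] := hx (absz i).+2.
by rewrite !hxy; [exact: h|lia|lia].
Qed.

Lemma suspension_det x y i : suspension x -> suspension y ->
  (forall i, (x i).1 = (y i).1) -> (x i).2 = (y i).2 -> forall j, i <= j -> x j = y j.
Proof.
move=> Sx Sy hl e j hj; apply: injective_projections => //.
have -> : j = i + (absz (j - i))%:Z by lia.
by apply: ord_inj; rewrite !suspension_phase// e.
Qed.

Hypothesis N0 : (0 < N)%N.

Lemma suspension_surj : set_surj suspension Z (fun x => fst \o x : config A).
Proof.
move=> z Zz; have hN i : (absz (i %% N%:Z)%Z < N)%N.
  have h1 : 0 <= (i %% N%:Z)%Z by rewrite modz_ge0//; lia.
  have h2 : (i %% N%:Z)%Z < N%:Z by rewrite ltz_pmod//; lia.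
  by move: (i %% N%:Z)%Z h1 h2 => m; lia.
exists (fun i => (z i, Ordinal (hN i))) => //; split=> // i.
apply: val_inj => /=; have h1 : 0 <= (i %% N%:Z)%Z by rewrite modz_ge0//; lia.
have [m em] : exists m : nat, (i %% N%:Z)%Z = m%:Z by exists (absz (i %% N%:Z)%Z); lia.
rewrite -modzDml em.
by have -> : m%:Z + 1 = m.+1%:Z; [lia|rewrite modz_nat].
Qed.

Lemma suspension_marked :
  well_marked (fun b : (A * 'I_N)%type => b.2 == 0%N :> nat) N suspension.
Proof.
move=> x Sx; split=> i.
  move=> j hij /eqP mi; have -> : j = i + (absz (j - i))%:Z by lia.
  rewrite suspension_phase// mi add0n => /(@dvdn_leq N _ _); lia.
exists (i + (N - (x i).2)%N%:Z); first by have := ltn_ord (x i).2; lia.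
by rewrite suspension_phase// subnKC ?modnn// ltnW.
Qed.
End Suspension.
Arguments suspension {A} Z N.

Lemma suspension_embedding (R : realType) (AX AY AZ : finType)
    (X : set (config AX)) (Y : set (config AY)) (Z : set (config AZ))
    (pi : config AX -> config AY) :
  mixing_sft X -> factor_code X Y pi -> subshift Y ->
  subshift Z -> (entropy R Z < entropy R Y)%E ->
  exists (A' : finType) (Z' : set (config A'))
      (chi : config A' -> config AZ) (psi : config A' -> config AX),
    [/\ subshift Z', factor_code Z' Z chi, finite_to_one Z' Z chi,
        sliding_block_code Z' X psi & set_inj Z' (pi \o psi)].
Proof.
move=> mX fpi hY hZ hent; have [Z0|Z0] := pselect (Z !=set0); last first.
  have noX (A : finType) (S : set (config A)) : ~ (S !=set0) -> S = set0.
    by move=> h; apply/seteqP; split=> // x Sx; apply: h; exists x.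
  exists void, set0, (fun x i => of_void _ (x i)), (fun x i => of_void _ (x i)).
  have sub0 : subshift (@set0 (config void)) by split; [exact: closed0|rewrite image_set0].
  rewrite (noX _ _ Z0); split=> //.
  - by split; [apply: local_code => //; exists 0%N|].
  - by apply: local_code => //; exists 0%N.
  - by move=> x y; rewrite in_set0.
have [N N0 hN] := encoding unit mX fpi hY hZ Z0 hent.
have hS := suspension_subshift N hZ.
have hS1 x : suspension Z N x -> Z (fst \o x : config AZ) by case.
have [|psi psi1 psi2] := hN (AZ * 'I_N)%type (suspension Z N) fst (fun=> tt)
  (fun b => b.2 == 0%N :> nat) hS hS1 (suspension_marked N0).
  move=> x y Sx Sy el em _; apply/funext => i.
  have [j hj mj] := (suspension_marked N0 Sx).2 (i - (2 * N)%N%:Z).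
  apply: (@suspension_det _ Z N x y j) => //; last by lia.
  by apply: ord_inj; have := mj; rewrite (em j) => /eqP->; apply/eqP.
exists (AZ * 'I_N)%type, (suspension Z N), (fun x => fst \o x), psi; split=> //.
  split; [exact: one_block_code|exact: suspension_surj].
move=> z _; apply: (@deterministic_finite _ 'I_N _ snd) => x y i [Sx ex] [Sy ey].
move=> e; apply: (@suspension_det _ Z N x y i) => // k.
by have := ex; rewrite -ey => /(congr1 (@^~ k)).
Qed.

(** * Synchronizing words in mixing sofic shifts *)

(** The vertices are the W-blocks of the covering shift of finite type T, and P u is
    the set of the blocks around the origin that may be reached after reading u. W
    is at least the memory K of T, so that two points of T sharing such a block can
    be spliced, and exceeds 2r, so that the splice does not change the labels on
    either side. *)
Lemma sofic_presentation (A : finType) (Z : set (config A)) : sofic Z ->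
  exists (V : finType) (P : seq A -> {set V}) (step : {set V} -> A -> {set V}),
  [/\ forall u a, P (rcons u a) = step (P u) a,
      forall u, P u != finset.set0 <-> language Z u
    & forall u v, P (u ++ v) \subset P v].
Proof.
move=> [hZ [B [T [f [sT [cf sf]]]]]]; have [hT _] := sT; have [_ fZ fsh] := cf.
have [r hr] := code_radius hT cf; have [K hK] := sft_splice sT.
have fshift n x : T x -> f (shiftn n x) = shiftn n (f x) by exact: code_shiftn hT fsh.
pose W := (K + 2 * r + 1)%N.
pose past (u : seq A) (v : W.-tuple B) x :=
  [/\ T x, v = block x (- r%:Z) W :> seq B & u = block (f x) (- (size u)%:Z) (size u)].
pose P (u : seq A) := [set v : W.-tuple B | `[< exists x, past u v x >]]%SET.
pose edge (v v' : W.-tuple B) a x := [/\ T x, v = block x (- r%:Z) W :> seq B,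
   v' = block x (1 - r%:Z) W :> seq B & f x 0 = a].
pose step (S : {set W.-tuple B}) a :=
  [set v' : W.-tuple B | `[< exists2 v, v \in S & exists x, edge v v' a x >]]%SET.
have szb x i : size (block x i W : seq B) == W by rewrite size_block.
exists (W.-tuple B : finType), P, step; split.
- move=> u a; apply/setP => v'; rewrite !finset.inE; apply/asboolP/asboolP.
    move=> [x [Tx ev]]; rewrite size_rcons block_rcons => /rcons_inj[eu ea].
    pose x' := shiftn (-1) x.
    have Tx' : T x' by exact: subshift_shiftn.
    exists (Tuple (szb x' (- r%:Z))).
      rewrite finset.inE; apply/asboolP; exists x'; split=> //.
      by rewrite {1}eu fshift// block_shiftn; congr block; lia.
    exists x'; split=> //.
      by rewrite ev block_shiftn; congr block; lia.
    by rewrite fshift// /shiftn ea; congr (f x _); lia.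
  move=> [v]; rewrite finset.inE => /asboolP[x [Tx ev eu]] [x' [Tx' ev' evv' ea]].
  have axx : agree (- r%:Z) (- r%:Z + W%:Z) x x' by apply/block_agree; rewrite -ev ev'.
  pose z : config B := fun i => if i < - r%:Z then x i else x' i.
  have Tz : T z.
    by apply: hK => // k hk; apply: axx; rewrite /W; lia.
  have zx i : i < - r%:Z + W%:Z -> z i = x i.
    by move=> hi; rewrite /z; case: ltP => // hi'; rewrite axx//; lia.
  have zx' i : - r%:Z <= i -> z i = x' i.
    by move=> hi; rewrite /z; case: ltP => //; lia.
  exists (shiftn 1 z); split; first exact: subshift_shiftn.
    rewrite evv' block_shiftn; apply/block_eq => k _; rewrite zx'; first by congr x'; lia.
    by lia.
  rewrite size_rcons block_rcons fshift//; congr rcons.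
    rewrite {1}eu; apply/block_eq => k hk; rewrite /shiftn.
    have -> : - (size u).+1%:Z + k%:Z + 1 = - (size u)%:Z + k%:Z by lia.
    by symmetry; apply: hr => // j hj; apply: zx; rewrite /W; lia.
  rewrite /shiftn; have -> : - (size u).+1%:Z + (size u)%:Z + 1 = 0 by lia.
  by rewrite -ea; apply: hr => // j hj; rewrite zx'//; lia.
- move=> u; split.
    move=> /finset.set0Pn[v]; rewrite finset.inE => /asboolP[x [Tx _ ->]].
    by apply: block_lang; exact: fZ.
  move=> /(lang_block (- (size u)%:Z) hZ)[_ /sf[x Tx <-] eu].
  apply/finset.set0Pn; exists (Tuple (szb x (- r%:Z))).
  by rewrite finset.inE; apply/asboolP; exists x.
- move=> u v; apply/fintype.subsetP => w; rewrite !finset.inE => /asboolP[x [Tx ew e]].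
  apply/asboolP; exists x; split=> //.
  move: e; rewrite size_cat block_cat => /eqP; rewrite eqseq_cat ?size_block//.
  by move=> /andP[_ /eqP {1}->]; congr block; lia.
Qed.

(** Take for m a word for which P m is nonempty and of least cardinality: P (u ++ m)
    is contained in P m, so it is equal to it as soon as u ++ m belongs to the
    language. *)
Lemma sofic_sync (A : finType) (Z : set (config A)) : sofic Z -> Z !=set0 ->
  exists (Q : finType) (P : seq A -> Q) (step : Q -> A -> Q) (alive : pred Q) (m : seq A),
  [/\ forall u a, P (rcons u a) = step (P u) a,
      forall u, alive (P u) <-> language Z u,
      language Z m
    & forall u, language Z (u ++ m) -> P (u ++ m) = P m].
Proof.
move=> sZ [z Zz]; have [V [P [step [h1 h2 h3]]]] := sofic_presentation sZ.
have ex : exists k, `[< exists m, P m != finset.set0 /\ #|P m| = k >].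
  exists #|P [::]|; apply/asboolP; exists [::]; split=> //; apply/h2.
  exact: (block_lang 0 0 Zz).
case: (ex_minnP ex) => k /asboolP[m [mn em]] kmin.
exists ({set V} : finType), P, step, (fun S => S != finset.set0), m; split=> //.
  exact/h2.
move=> u /h2 um; apply/eqP; rewrite eqEcard h3 em.
by apply: kmin; apply/asboolP; exists (u ++ m).
Qed.

Definition rep (A : Type) (c v : seq A) (k : nat) : seq A :=
  c ++ iter k (fun t => v ++ c ++ t) [::].

Lemma repS (A : Type) (c v : seq A) k : rep c v k.+1 = (c ++ v) ++ rep c v k.
Proof. by rewrite /rep iterS -!catA. Qed.

Lemma size_rep (A : Type) (c v : seq A) k :
  size (rep c v k) = (k * size (c ++ v) + size c)%N.
Proof.
by elim: k => [|k IH]; [rewrite /rep cats0|rewrite repS size_cat IH mulSn addnA].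
Qed.

Lemma nth_rep (A : Type) (d : A) (c v : seq A) k i : (0 < size v)%N ->
  (i < size (rep c v k))%N -> nth d (rep c v k) i = nth d (c ++ v) (i %% size (c ++ v)).
Proof.
move=> v0; elim: k i => [|k IH] i.
  rewrite /rep cats0 => hi; rewrite modn_small ?nth_cat ?hi// size_cat; lia.
rewrite size_rep repS nth_cat mulSn => hi; case: ltnP => h; first by rewrite modn_small.
rewrite IH; last by rewrite size_rep; lia.
by rewrite -{2}(subnK h) modnDr.
Qed.

Lemma irreducible_gap (A : finType) (Z : set (config A)) g n u w :
  strongly_irreducible_gap Z g -> (g <= n)%N -> language Z u -> language Z w ->
  exists v, size v = n /\ language Z (u ++ v ++ w).
Proof.
move=> [_ hg] gn lu lw; have [e [se le']] := lang_extend (n - g) lu.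
have [v [sv _ lv]] := hg _ _ le' lw; exists (e ++ v); rewrite size_cat se sv; split.
  by lia.
by move: lv; rewrite -!catA.
Qed.

Section Sync.
Variables (A Q : finType) (Z : set (config A)) (P : seq A -> Q) (step : Q -> A -> Q).
Variables (alive : pred Q).
Hypothesis P_rcons : forall u a, P (rcons u a) = step (P u) a.
Hypothesis P_alive : forall u, alive (P u) <-> language Z u.

Definition synchronizing (c : seq A) : Prop :=
  language Z c /\ forall u, language Z (u ++ c) -> P (u ++ c) = P c.

Lemma P_cat u v : P (u ++ v) = foldl step (P u) v.
Proof.
elim/last_ind: v => [|v a IH]; first by rewrite cats0.
by rewrite -rcons_cat P_rcons IH foldl_rcons.
Qed.

(** A synchronizing word erases the past: what may follow it does not depend on what
    precedes it. *)
Lemma sync_lang u c w : synchronizing c -> language Z (u ++ c) -> language Z (c ++ w) ->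
  language Z (u ++ c ++ w).
Proof.
move=> [_ hc] uc cw; apply/P_alive; rewrite catA P_cat hc// -P_cat; exact/P_alive.
Qed.

Lemma sync_suffix u c : synchronizing c -> language Z (u ++ c) -> synchronizing (u ++ c).
Proof. by move=> [_ hc] uc; split=> // w wuc; rewrite catA !hc// -catA. Qed.

Lemma rep_lang c v k : synchronizing c -> language Z (c ++ v ++ c) -> language Z (rep c v k).
Proof.
move=> sc cvc; elim: k => [|k IH]; first by rewrite /rep cats0; case: sc.
by rewrite repS /rep -catA catA; apply: sync_lang => //; rewrite -catA.
Qed.

(** The words rep c v k are pieces of one periodic sequence, hence have at most |c
    ++ v| factors of each length, fewer than Z has for some length. *)
Lemma unbounded_avoid c v : (0 < size v)%N ->
  (forall k, exists n, (k < nblocks Z n)%N) ->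
  exists w, language Z w /\ forall k, ~~ infix w (rep c v k).
Proof.
move=> v0 unb; pose b := c ++ v; have [n hn] := unb (size b).
have b0 : (0 < size b)%N by rewrite size_cat; lia.
have [d _] : exists d : A, True.
  by move: b0; case: (b) => // d; exists d.
pose F (s : 'I_(size b)) := [tuple nth d b ((s + i) %% size b)%N | i < n].
have /subsetPn[w] : ~~ ([set w : n.-tuple A | `[< language Z w >]]%SET \subset F @: [set: 'I_(size b)]%SET).
  apply/negP => /subset_leq_card h.
  by have := leq_trans (leq_trans hn h) (leq_imset_card F _); rewrite cardsT card_ord ltnn.
rewrite finset.inE => /asboolP lw hw; exists w; split=> // k; apply/negP.
move=> /infixP[s1 [s2 e]]; move/negP: hw; apply; apply/imsetP.
exists (Ordinal (ltn_pmod (size s1) b0)) => //.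
apply: eq_from_tnth => i; rewrite tnth_mktuple /= modnDml.
have hsz : (size s1 + i < size (rep c v k))%N.
  by rewrite e !size_cat size_tuple; have := ltn_ord i; lia.
rewrite -(nth_rep d v0 hsz) e nth_cat ltnNge leq_addr /=.
by rewrite addKn nth_cat size_tuple ltn_ord -tnth_nth.
Qed.

(** M starts with a word w that no rep m v k contains. Therefore, after a long rep m
    v n followed by a bridge and M, the first occurrence of M comes after a long
    stretch without M; u is the prefix that ends there. *)
Lemma marker_word g m : strongly_irreducible_gap Z g -> synchronizing m ->
  (forall k, exists n, (k < nblocks Z n)%N) ->
  exists M, forall n, exists u, [/\ synchronizing u, (n <= size u)%N, suffix M u &
    ~~ infix M (take (size u).-1 u)].
Proof.
move=> hg sm unb; have [g0 hgap] := hg; have lm := sm.1.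
have [v [sv lmvm]] := irreducible_gap hg (leqnn g) lm lm.
have v0 : (0 < size v)%N by rewrite sv.
have [w [lw hw]] := unbounded_avoid m v0 unb.
have [v' [_ lM]] := irreducible_gap hg (leqnn g) lw lm.
exists (w ++ v' ++ m) => n; set M := w ++ v' ++ m.
have lrep := rep_lang n sm lmvm.
have [v'' [_ lH]] := irreducible_gap hg (leqnn g) lrep lM.
set H := rep m v n ++ v'' ++ M in lH.
have wM : infix w M by rewrite /M prefixW// prefix_prefix.
have ex : exists j, infix M (take j H).
  by exists (size H); rewrite take_size /H catA infix_catl// infix_refl.
case: (ex_minnP ex) => j hj jmin.
have jH : (j <= size H)%N by apply: jmin; rewrite take_size /H catA infix_catl// infix_refl.
have jrep : (size (rep m v n) < j)%N.
  rewrite ltnNge; apply/negP => h; move: hj; rewrite /H takel_cat// => hj.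
  have := hw n; rewrite (infix_trans wM)//; apply: infix_trans hj _; exact: infix_take.
have szu : size (take j H) = j by rewrite size_takel.
have nM : ~~ infix M (take j.-1 H).
  apply/negP => /jmin; have : (0 < j)%N by lia.
  lia.
have sM : suffix M (take j H).
  have [a _] : exists a : A, True by move: v0; case: (v) => // a; exists a.
  have ej : j = j.-1.+1 by lia.
  move: hj; rewrite ej (take_nth a); last by lia.
  by rewrite infix_rconsl (negbTE nM) orbF.
exists (take j H); rewrite szu; split=> //.
- have /suffixP[u' eu] := sM; rewrite eu /M !catA; apply: sync_suffix => //.
  have : language Z (take j H) by move: lH; rewrite -{1}(cat_take_drop j H) => /lang_catl.
  by rewrite eu /M !catA.
- apply: leq_trans (ltnW jrep); rewrite size_rep size_cat; nia.
- by rewrite take_takel// leq_pred.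
Qed.
End Sync.

(** * A mixing finite-type cover with markers *)

Section Automaton.

Variables (A Q : finType) (Z : set (config A)) (P : seq A -> Q) (step : Q -> A -> Q).

Variables (alive : pred Q).

Hypothesis P_rcons : forall u a, P (rcons u a) = step (P u) a.

Hypothesis P_alive : forall u, alive (P u) <-> language Z u.

Variables (M u : seq A) (n : nat).

Hypothesis hZ : subshift Z.

Let K := (n.+1 + size M)%N.

Variables (w0 : K.-tuple A).

(** M has just been read, and had not been read during the n + 1 previous steps;
    this is visible in a window of length K. *)
Definition fresh (w : seq A) : bool := suffix M w && ~~ infix M (take K.-1 w).

Definition push (w : K.-tuple A) (a : A) : K.-tuple A := [tuple of behead (rcons w a)].

(** A state consists of the state of the presentation, the last K letters, and a
    countdown whose zeros are the marks. *)
Definition state : finType := (Q * K.-tuple A * 'I_n.+1)%type.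

Definition next (s : state) (a : A) : state :=
  let w := push s.1.2 a in
  (step s.1.1 a, w, if fresh w || (s.2 == 0%N :> nat) then ord_max else inord s.2.-1).

Definition run (s : state) (w : seq A) : state := foldl next s w.

Lemma run_cat s v w : run s (v ++ w) = run (run s v) w.
Proof. exact: foldl_cat. Qed.

Lemma run_rcons s w a : run s (rcons w a) = next (run s w) a.
Proof. exact: foldl_rcons. Qed.

Lemma run_fst s w : (run s w).1.1 = foldl step s.1.1 w.
Proof. by elim: w s => //= a w IH s; rewrite IH. Qed.

Lemma run_window s w : (run s w).1.2 = drop (size w) (s.1.2 ++ w) :> seq A.
Proof.
elim/last_ind: w => [|w a IH]; first by rewrite cats0 drop0.
rewrite run_rcons /= IH -drop1 -rcons_cat -drop_rcons; last by rewrite size_cat leq_addl.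
by rewrite drop_drop size_rcons add1n.
Qed.

Lemma run_window_long s w : (K <= size w)%N -> (run s w).1.2 = drop (size w - K) w :> seq A.
Proof.
move=> hw; rewrite run_window drop_cat size_tuple ltnNge hw /=.
by [].
Qed.

(** The window w0 and the countdown 0 are arbitrary: u is long enough to erase them. *)
Definition s0 : state := run (P [::], w0, ord0) u.

Lemma s0_fst : s0.1.1 = P u.
Proof. by rewrite /s0 run_fst -(P_cat P_rcons). Qed.

Lemma run_s0_fst h : (run s0 h).1.1 = P (u ++ h).
Proof. by rewrite run_fst s0_fst -(P_cat P_rcons). Qed.

Definition reach (s : state) : Prop := exists2 h, language Z (u ++ h) & s = run s0 h.

(** Only states accessible from the synchronized one through the language are kept;
    this makes the graph of states irreducible. *)
Definition ok (b b' : state * A) : Prop :=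
  [/\ reach b.1, reach b'.1 & b'.1 = next b.1 b.2].

Definition sync_cover : set (config (state * A)%type) :=
  [set x | forall i, ok (x i) (x (i + 1))].

Lemma cover_sft : sft sync_cover.
Proof. exact: sft_step. Qed.

Lemma cover_run x i k : sync_cover x ->
  (x (i + k%:Z)).1 = run (x i).1 (block (snd \o x : config A) i k).
Proof.
move=> hx; elim: k => [|k IH]; first by rewrite addr0.
have -> : i + k.+1%:Z = i + k%:Z + 1 by lia.
have [_ _ ->] := hx (i + k%:Z); rewrite block_rcons run_rcons -IH //.
Qed.

Lemma cover_reach x i : sync_cover x -> reach (x i).1.
Proof. by move=> /(_ i)[]. Qed.

(** A run between two accessible states extends to a run that starts at the
    synchronized state, so its label follows u in the language. *)
Lemma cover_label x : sync_cover x -> Z (snd \o x : config A).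
Proof.
move=> hx; apply: subshift_lang => // k.
have [h lh eh] := cover_reach (- k%:Z) hx.
have [h' lh' eh'] := cover_reach (- k%:Z + (k + k)%N%:Z) hx.
have := cover_run (- k%:Z) (k + k) hx; rewrite eh eh' -run_cat => /(congr1 (fun s => s.1.1)).
rewrite !run_s0_fst => e; have := (P_alive (u ++ h')).2 lh'; rewrite e => /P_alive.
by rewrite catA => /lang_catr.
Qed.

Lemma cover_det x y i : sync_cover x -> sync_cover y -> (forall i, (x i).2 = (y i).2) ->
  (x i).1 = (y i).1 -> forall j, i <= j -> x j = y j.
Proof.
move=> hx hy hl e j hj; apply: injective_projections => //.
have -> : j = i + (absz (j - i))%:Z by lia.
rewrite !cover_run// e; congr run; apply/block_eq => k _ /=; exact: hl.
Qed.

Lemma reach_prefix h w k : language Z (u ++ h ++ w) -> reach (run (run s0 h) (take k w)).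
Proof.
move=> l; exists (h ++ take k w); last by rewrite run_cat.
by move: l; rewrite -{1}(cat_take_drop k w) !catA => /lang_catl; rewrite -catA.
Qed.

Lemma ok_run h w k (a : A) : language Z (u ++ h ++ w) -> (k < size w)%N ->
  forall b', b'.1 = run (run s0 h) (take k.+1 w) ->
  ok (run (run s0 h) (take k w), nth a w k) b'.
Proof.
move=> l hk b' eb; split=> /=; rewrite ?eb; [exact: reach_prefix|exact: reach_prefix|].
by rewrite (take_nth a)// run_rcons.
Qed.

Hypothesis u_sync : synchronizing Z P u.

(** Any word of Z can follow u after a bridge, so it labels a run; the runs for
    longer and longer windows of z have a limit point. *)
Lemma cover_surj g : strongly_irreducible_gap Z g ->
  set_surj sync_cover Z (fun x => snd \o x : config A).
Proof.
move=> hg z Zz; have lu := u_sync.1.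
have hk (k : nat) : exists x : config (state * A)%type, forall i, - k%:Z <= i < k%:Z ->
    (x i).2 = z i /\ ok (x i) (x (i + 1)).
  pose w := block z (- k%:Z) (k + k).
  have [v [_ l]] := irreducible_gap hg (leqnn g) lu (block_lang (- k%:Z) (k + k) Zz).
  exists (fun i => (run (run s0 v) (take (absz (i + k%:Z)) w), z i)) => i hi; split=> //.
  have ez : z i = nth (z 0) w (absz (i + k%:Z)%R).
    by rewrite nth_block; [congr z; lia|lia].
  rewrite ez; apply: ok_run => //; first by rewrite size_block; lia.
  by rewrite /=; congr (run _ (take _ _)); lia.
pose xs k := projT1 (cid (hk k)).
have hxs k i : - k%:Z <= i < k%:Z -> (xs k i).2 = z i /\ ok (xs k i) (xs k (i + 1)).
  exact: (projT2 (cid (hk k)) i).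
have [x hx] := config_limit xs.
have key i : (x i).2 = z i /\ ok (x i) (x (i + 1)).
  have [m hm ag] := hx (absz i).+2.
  by rewrite !ag; [apply: hxs; lia|lia|lia].
by exists x; [move=> i; exact: (key i).2|apply/funext => i; exact: (key i).1].
Qed.

Lemma cover_finite z : finite_set (fiber sync_cover (fun x => snd \o x : config A) z).
Proof.
apply: (@deterministic_finite _ state _ fst) => x y i [hx ex] [hy ey] e.
by apply: cover_det => // k; have := ex; rewrite -ey => /(congr1 (@^~ k)).
Qed.

Lemma next_ord s a : (next s a).2 =
  (if fresh (push s.1.2 a) || (s.2 == 0%N :> nat) then n else s.2.-1) :> nat.
Proof.
rewrite /next /=; case: ifP => h //=; rewrite inordK//.
exact: leq_ltn_trans (leq_pred _) (ltn_ord _).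
Qed.

Lemma cover_window x i : sync_cover x ->
  (x i).1.1.2 = block (snd \o x : config A) (i - K%:Z) K :> seq A.
Proof.
move=> hx; have := cover_run (i - K%:Z) K hx; rewrite subrK => ->.
by rewrite run_window_long size_block// subnn drop0.
Qed.

Lemma cover_ord x i : sync_cover x -> (x (i + 1)).1.2 =
  (if fresh (x (i + 1)).1.1.2 || ((x i).1.2 == 0%N :> nat) then n else (x i).1.2.-1) :> nat.
Proof. by move=> /(_ i)[_ _ e]; rewrite e next_ord. Qed.

(** The window of the later time contains the earlier occurrence of M. *)
Lemma fresh_sep x i k : sync_cover x -> fresh (x i).1.1.2 -> (0 < k <= n)%N ->
  ~~ fresh (x (i + k%:Z)).1.1.2.
Proof.
move=> hx /andP[/suffixP[t et] _] hk; apply/negP => /andP[_ /negP]; apply.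
rewrite !cover_window// in et *.
have eK : K = (n.+1 + size M)%N by [].
have st : size t = n.+1.
  by move/(congr1 size): et; rewrite size_cat size_block eK => /addIn ->.
have eM : M = block (snd \o x : config A) (i - (size M)%:Z) (size M).
  move: et; rewrite {1}eK block_cat => /eqP; rewrite eqseq_cat ?size_block//.
  by move=> /andP[_ /eqP {1}<-]; congr block; lia.
have -> : K = ((n.+1 - k) + size M + k.-1).+1 by lia.
rewrite block_rcons -cats1 take_cat size_block /= ltnn subnn take0 cats0.
rewrite !block_cat {1}eM; apply/infixP; eexists; eexists; rewrite -catA; congr (_ ++ (_ ++ _)).
congr block; lia.
Qed.

Definition mark (b : state * A) : bool := b.1.2 == 0%N :> nat.

Lemma countdown x i k : sync_cover x -> (k <= (x i).1.2)%N ->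
  (forall j, (0 < j <= k)%N -> ~~ fresh (x (i + j%:Z)).1.1.2) ->
  (x (i + k%:Z)).1.2 = ((x i).1.2 - k)%N :> nat.
Proof.
move=> hx; elim: k => [|k IH] hk hev; first by rewrite addr0 subn0.
have -> : i + k.+1%:Z = i + k%:Z + 1 by lia.
rewrite cover_ord// IH; [|lia|by move=> j hj; apply: hev; lia].
have := hev k.+1 ltac:(lia); have -> : i + k.+1%:Z = i + k%:Z + 1 by lia.
by move/negbTE => ->; rewrite ifF; [lia|apply/negbTE; lia].
Qed.

(** The countdown restarts from n, so two zeros are at least n + 1 apart. A reset by
    a fresh occurrence of M can delay a zero once only, because the next fresh
    occurrence comes more than n steps later. *)
Lemma cover_marked : well_marked mark n.+1 sync_cover.
Proof.
move=> x hx; split.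
  move=> i j hij /eqP mi /eqP mj.
  have h k : (n.+1 <= (x (i + k.+1%:Z)%R).1.2 + k.+1)%N.
    elim: k => [|k IH]; first by rewrite cover_ord// mi eqxx orbT; lia.
    have -> : i + k.+2%:Z = i + k.+1%:Z + 1 by lia.
    by rewrite cover_ord//; case: ifP => _; lia.
  have := h (absz (j - i - 1)%R); have -> : i + (absz (j - i - 1)%R).+1%:Z = j by lia.
  by rewrite mj; lia.
move=> i; set D := (x i).1.2; have Dn := ltn_ord D.
have [hev|] := pselect (exists j, (0 < j <= D)%N /\ fresh (x (i + j%:Z)).1.1.2); last first.
  move=> /forallNP hno; exists (i + D%:Z); first by lia.
  rewrite /mark countdown// -/D ?subnn// => j hj; apply/negP => h.
  by apply: (hno j).
have [j [hj ej]] := hev.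
have Dj : (x (i + j%:Z)).1.2 = n :> nat.
  have := cover_ord (i + (j.-1)%:Z) hx.
  have -> : i + (j.-1)%:Z + 1 = i + j%:Z by lia.
  by rewrite ej.
exists (i + j%:Z + n%:Z); first by lia.
rewrite /mark countdown// ?Dj ?subnn// => k hk; exact: fresh_sep.
Qed.

(** At a mark the countdown is 0 and the window is made of labels, so that the
    element of Q completes the state; the labels then determine the states to the
    right. *)
Lemma cover_determined x y : sync_cover x -> sync_cover y -> (forall i, (x i).2 = (y i).2) ->
  (forall i, mark (x i) = mark (y i)) ->
  (forall i, mark (x i) -> (x i).1.1.1 = (y i).1.1.1) -> x = y.
Proof.
move=> hx hy el em es; apply/funext => i.
have [j hj mj] := (cover_marked hx).2 (i - (2 * n.+1)%N%:Z).
apply: (cover_det (i := j)) => //; last by lia.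
have e1 := es j mj.
have e2 : (x j).1.1.2 = (y j).1.1.2.
  apply: val_inj; rewrite /= !cover_window//; apply/block_eq => k _ /=; exact: el.
have e3 : (x j).1.2 = (y j).1.2.
  apply: ord_inj; have := mj; rewrite em => /eqP ->; exact/eqP.
by move: e1 e2 e3; case: (x j).1 => [[? ?] ?]; case: (y j).1 => [[? ?] ?] /= -> -> ->.
Qed.

Hypothesis u_long : (K <= size u)%N.

Hypothesis u_suffix : suffix M u.

Hypothesis u_infix : ~~ infix M (take (size u).-1 u).

Lemma fresh_u : fresh (drop (size u - K) u).
Proof.
apply/andP; split.
  have [u' eu] := suffixP u_suffix; apply/suffixP.
  exists (drop (size u - K) u'); rewrite {2}eu drop_cat; case: ltnP => //.
  by move: u_long; rewrite eu size_cat /K; lia.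
apply: contra u_infix => h; apply: infix_trans h _.
rewrite take_drop; have -> : (K.-1 + (size u - K) = (size u).-1)%N.
  by move: u_long; rewrite /K; lia.
apply/infixP; exists (take (size u - K) (take (size u).-1 u)), [::].
by rewrite cats0 cat_take_drop.
Qed.

Lemma run_u_ord s : (run s u).2 = ord_max.
Proof.
have ew := run_window_long s u_long; have := fresh_u; rewrite -ew.
have : (0 < size u)%N by move: u_long; rewrite /K; lia.
case/lastP: (u) => [|v a _] //.
by rewrite run_rcons /= => ->.
Qed.

(** After u the presentation is synchronized, the window lies inside u, and the
    countdown has just been reset because u ends with a fresh occurrence of M. *)
Lemma run_u s h : s.1.1 = P h -> language Z (h ++ u) -> run s u = s0.
Proof.
move=> es hu.
have e1 : (run s u).1.1 = s0.1.1.
  by rewrite s0_fst run_fst es -(P_cat P_rcons) u_sync.2.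
have e2 : (run s u).1.2 = s0.1.2 by apply: val_inj; rewrite /= !run_window_long.
have e3 : (run s u).2 = s0.2 by rewrite /s0 !run_u_ord.
by move: e1 e2 e3; case: (run s u) => [[? ?] ?]; case: s0 => [[? ?] ?] /= -> -> ->.
Qed.

(** The path leads from the left state to the synchronized state through u, returns
    to it by a loop of adjustable length, and then follows the word hm s to the
    right state s. The loop absorbs the length of hm s, and so the gap is constant. *)
Lemma cover_glue g : strongly_irreducible_gap Z g -> exists2 G, (0 < G)%N & glueable sync_cover G.
Proof.
move=> hg; have [g0 _] := hg; have lu := u_sync.1.
have [hm hhm] : exists hm : state -> seq A, forall s, reach s ->
    language Z (u ++ hm s) /\ s = run s0 (hm s).
  suff h s : exists h, reach s -> language Z (u ++ h) /\ s = run s0 h.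
    by have [hm hhm] := choice h; exists hm.
  have [[h l e]|nr] := pselect (reach s); last by exists [::].
  by exists h.
pose B := (\max_(s : state) size (hm s))%N.
pose G := (g + size u + (g + B) + size u)%N.
exists G => [|x y t hx hy]; first by rewrite /G; lia.
have [h lh eh] := cover_reach t hx.
have ry := cover_reach (t + G%:Z) hy; have [lh' eh'] := hhm _ ry.
set h' := hm _ in lh' eh'.
have hB : (size h' <= B)%N by rewrite /B /h'; exact: (leq_bigmax (F := fun s => size (hm s))).
have [v1 [sv1 l1]] := irreducible_gap hg (leqnn g) lh lu.
have [v2 [sv2 l2]] := irreducible_gap (n := (g + B - size h')%N) hg ltac:(lia) lu lu.
have l3 : language Z (u ++ v2 ++ u ++ h') 
  by rewrite catA; apply: (sync_lang P_rcons P_alive u_sync _ lh'); rewrite -catA.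
pose w := v1 ++ u ++ v2 ++ u ++ h'.
have lw : language Z (u ++ h ++ w).
  have -> : u ++ h ++ w = (u ++ h ++ v1) ++ u ++ v2 ++ u ++ h' by rewrite /w -!catA.
  by apply: (sync_lang P_rcons P_alive u_sync _ l3); move: l1; rewrite -!catA.
have sw : size w = G by rewrite /w !size_cat sv1 sv2 /G; lia.
have rw : run (x t).1 w = (y (t + G%:Z)).1.
  have ra : run s0 (h ++ v1 ++ u) = s0.
    rewrite catA run_cat (@run_u _ (u ++ h ++ v1)) ?run_s0_fst//.
    by move: l1; rewrite -!catA.
  have rb : run s0 (v2 ++ u) = s0.
    by rewrite run_cat (@run_u _ (u ++ v2)) ?run_s0_fst// -catA.
  rewrite eh -run_cat.
  have -> : h ++ w = (h ++ v1 ++ u) ++ (v2 ++ u) ++ h' by rewrite /w -!catA.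
  by rewrite run_cat ra run_cat rb -eh'.
pose z : config (state * A)%type := fun i => if i < t then x i else
  if i < t + G%:Z then (run (x t).1 (take (absz (i - t)%R) w), nth (x i).2 w (absz (i - t)%R))
  else y i.
have zst i : t <= i <= t + G%:Z -> (z i).1 = run (x t).1 (take (absz (i - t)%R) w).
  move=> hi; rewrite /z; case: ltP => [|_]; first by lia.
  case: ltP => // hi'; have -> : i = t + G%:Z by lia.
  by rewrite -rw take_oversize// sw; lia.
exists z; split.
- move=> i; have [it|it] := ltP (i + 1) t.
    by rewrite /z it ifT; [exact: hx|lia].
  have [e|ne] := eqVneq (i + 1) t.
    have [r1 r2 e3] := hx i; rewrite /z ifT; last by lia.
    by split=> //; rewrite -/(z _) zst ?e; rewrite ?subrr ?take0 -?e//; lia.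
  have [iG|iG] := ltP i (t + G%:Z).
    rewrite {1}/z ifF; last by apply/negbTE; lia.
    rewrite iG eh; apply: ok_run => //; first by lia.
    by rewrite zst; [rewrite eh; congr (run _ (take _ _)); lia|lia].
  rewrite /z ifF; last by apply/negbTE; lia.
  rewrite ifF; last by apply/negbTE; lia.
  rewrite ifF; last by apply/negbTE; lia.
  rewrite ifF; last by apply/negbTE; lia.
  exact: hy.
- by move=> i hi; rewrite /z hi.
- move=> i hi; rewrite /z ifF; last by apply/negbTE; lia.
  by rewrite ifF//; apply/negbTE; lia.
Qed.

Lemma cover_sync x i : sync_cover x ->
  block (snd \o x : config A) i (size u) = u -> (x (i + (size u)%:Z)).1 = s0.
Proof.
move=> hx eb; have := cover_run i (size u) hx; rewrite eb => ->.
have [h lh eh] := cover_reach i hx.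
rewrite eh (@run_u _ (u ++ h)) ?run_s0_fst//.
have [h' lh' eh'] := cover_reach (i + (size u)%:Z) hx.
have := cover_run i (size u) hx; rewrite eb eh eh' -run_cat => /(congr1 (fun s => s.1.1)).
rewrite !run_s0_fst => e; have := (P_alive (u ++ h')).2 lh'; rewrite e => /P_alive.
by rewrite catA.
Qed.

(** In the periodic point (u v)^oo each u puts all preimages into the same state,
    and determinism does the rest. *)
Lemma cover_degree g : strongly_irreducible_gap Z g ->
  almost_invertible sync_cover Z (fun x => snd \o x : config A).
Proof.
move=> hg; split; last first.
  move=> z Zz; have [x hx ex] := cover_surj hg Zz.
  have := @card_set1 _ x; rewrite card_eq_sym => /card_eqPle[h _].
  apply: card_le_trans h _; apply: subset_card_le => _ ->; by split.
have lu := u_sync.1; have [v [sv lv]] := irreducible_gap hg (leqnn g) lu lu.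
have [g0 _] := hg; have v0 : (0 < size v)%N by rewrite sv.
have u0 : (0 < size u)%N by move: u_long; rewrite /K; lia.
have [d _] : exists d : A, True by case: (v) v0 => // d; exists d.
pose p := size (u ++ v).
have pE : p = (size u + g)%N by rewrite /p size_cat sv.
pose z : config A := fun i => nth d (u ++ v) (absz (i %% p%:Z)%Z).
have zrep k j : (j < size (rep u v k))%N -> forall q : int, z (q * p%:Z + j%:Z) = nth d (rep u v k) j.
  move=> hj q; rewrite nth_rep// -/p /z modzMDl modz_nat //.
have Zz : Z z.
  apply: subshift_lang => // k.
  have lb : language Z (block z (- k%:Z * p%:Z) ((k + k) * p)).
    suff -> : block z (- k%:Z * p%:Z) ((k + k) * p) = take ((k + k) * p) (rep u v (k + k)).
      have := rep_lang P_rcons P_alive (k + k) u_sync lv.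
      by rewrite -{1}(cat_take_drop ((k + k) * p) (rep _ _ _)) => /lang_catl.
    apply: (@eq_from_nth _ d); rewrite size_block.
      by rewrite size_takel// size_rep -/p leq_addr.
    move=> j hj; rewrite nth_block// nth_take//; apply: zrep.
    by rewrite size_rep -/p; lia.
  have kp : (k <= k * p)%N by rewrite leq_pmulr// pE; lia.
  have e : ((k + k) * p = (k * p - k) + (k + k + (k * p - k)))%N by lia.
  move: lb; rewrite e block_cat => /lang_catr; rewrite block_cat => /lang_catl.
  by congr (language Z (block z _ _)); lia.
exists z => //; have [x hx ex] := cover_surj hg Zz.
have -> : fiber sync_cover (fun x => snd \o x : config A) z = [set x].
  apply/seteqP; split=> [y [hy ey]|_ ->]; last by split.
  apply/funext => i.
  have ub (x' : config (state * A)%type) : snd \o x' = z -> forall q : int,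
      block (snd \o x' : config A) (q * p%:Z) (size u) = u.
    move=> -> q; apply: (@eq_from_nth _ d); rewrite size_block// => j hj.
    rewrite nth_block// (zrep 0%N) /rep cats0//.
  pose q : int := - (absz i).+1%:Z.
  have qp : q * p%:Z + (size u)%:Z <= i.
    have : ((absz i).+1 * size u <= (absz i).+1 * p)%N by rewrite leq_mul2l pE leq_addr orbT.
    rewrite /q; nia.
  apply: (cover_det (i := q * p%:Z + (size u)%:Z)) => //.
    by move=> k; have := ey; rewrite -ex => /(congr1 (@^~ k)).
  by rewrite !cover_sync// ub.
exact: card_set1.
Qed.

End Automaton.

(** * The embedding theorem *)

Lemma sync_cover_embedding (R : realType) (AX AY AZ : finType)
    (X : set (config AX)) (Y : set (config AY)) (Z : set (config AZ))
    (pi : config AX -> config AY) :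
  mixing_sft X -> factor_code X Y pi -> subshift Y ->
  (entropy R Z < entropy R Y)%E -> mixing_sofic Z -> (0 < entropy R Z)%E ->
    exists (A' : finType) (Z' : set (config A'))
      (chi : config A' -> config AZ) (psi : config A' -> config AX),
    [/\ [/\ subshift Z', factor_code Z' Z chi, finite_to_one Z' Z chi,
            sliding_block_code Z' X psi & set_inj Z' (pi \o psi)],
        mixing_sft Z' & almost_invertible Z' Z chi].
Proof.
move=> mX fpi hY hent [sZ [g hg]] /entropy_unbounded[Z0 unb]; have [hZ _] := sZ.
have [Q [P [step [alive [m [h1 h2 lm hm]]]]]] := sofic_sync sZ Z0.
have [M hM] := marker_word h1 h2 hg (conj lm hm) unb.
have [[//|n] _ hN] := encoding Q mX fpi hY hZ Z0 hent.
have [u [u1 u2 u3 u4]] := hM (n.+1 + size M)%N.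
have [z Zz] := Z0; pose w0 := [tuple of nseq (n.+1 + size M) (z 0)].
pose C := sync_cover Z P step u w0.
have hC : subshift C by case: (cover_sft Z P step u w0).
have [G G0 hG] := cover_glue h1 h2 w0 u1 u2 u3 u4 hg.
have hlab x : C x -> Z (snd \o x : config AZ) by exact: (cover_label h1 h2 hZ).
have [|psi psi1 psi2] := hN _ C snd (fun b => b.1.1.1) (@mark _ _ M n) hC hlab
  (@cover_marked _ _ _ _ _ _ _ _ w0).
  by move=> x y; exact: cover_determined.
exists (state Q M n * AZ)%type, C, (fun x => snd \o x : config AZ), psi; split.
- split=> //.
  + split; [exact: one_block_code|exact: (cover_surj step w0 u1 hg)].
  + by move=> y _; exact: cover_finite.
- split; first exact: cover_sft.
  exact: glue_irreducible hC G0 hG.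
- exact: (cover_degree h1 h2 hZ w0 u1 u2 u3 u4 hg).
Qed.

Theorem corollary1p3 (R : realType) (AX AY AZ : finType)
    (X : set (config AX)) (Y : set (config AY)) (Z : set (config AZ))
    (pi : config AX -> config AY)
    (mixX : mixing_sft X) (mixY : mixing_sofic Y) (facpi : factor_code X Y pi)
    (subZ : subshift Z) (hZY : (entropy R Z < entropy R Y)%E) :
  (exists (A' : finType) (Z' : set (config A'))
      (chi : config A' -> config AZ) (psi : config A' -> config AX),
    [/\ subshift Z', factor_code Z' Z chi, finite_to_one Z' Z chi,
        sliding_block_code Z' X psi & set_inj Z' (pi \o psi)]) /\
  (mixing_sofic Z -> (0 < entropy R Z)%E ->
    exists (A' : finType) (Z' : set (config A'))
      (chi : config A' -> config AZ) (psi : config A' -> config AX),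
    [/\ [/\ subshift Z', factor_code Z' Z chi, finite_to_one Z' Z chi,
            sliding_block_code Z' X psi & set_inj Z' (pi \o psi)],
        mixing_sft Z' & almost_invertible Z' Z chi]).
Proof.
have [[hY _] _] := mixY; split; first exact: suspension_embedding mixX facpi hY subZ hZY.
exact: sync_cover_embedding mixX facpi hY hZY.
Qed.
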